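(* There is exactly one non-zero class in $(Q\mathscr P_5)_{21}$ that is invariant under the action of $GL_5=GL(5,\mathbb Z/2)$. Consequently, $(Q\mathscr P_5)_{21}^{GL_5}$ is one-dimensional over $\mathbb Z/2$. (Here $21=13\cdot 2^1-5$.)
   Context: Let $\mathcal A_2$ be the mod 2 Steenrod algebra and $\mathcal A_2^+$ its augmentation ideal. Let $\mathscr P_d=\mathbb Z/2[x_1,\dots,x_d]$ with each $x_i$ of degree 1, regarded as a left $\mathcal A_2$-module by $Sq^1(x_i)=x_i^2$, $Sq^k(x_i)=0$ for $k>1$, and the Cartan formula. Put $Q\mathscr P_d=\mathscr P_d/\mathcal A_2^+\mathscr P_d$, with degree-$n$ component $(Q\mathscr P_d)_n$. The group $GL_d=GL(d,\mathbb Z/2)$ acts on $\mathscr P_d$ by linear substitution of the variables: for $w=(w_{ij})\in GL_d$, $x_j\mapsto \sum_{i}w_{ij}x_i$. This commutes with the $\mathcal A_2$-action, so $GL_d$ acts on each $(Q\mathscr P_d)_n$; $(Q\mathscr P_d)_n^{GL_d}$ denotes the subspace of invariants. *)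

(* Defs.v *)
From HB Require Import structures.
From mathcomp Require Import all_boot all_order all_algebra.
From mathcomp Require Import mpoly.
From mathcomp Require Import boolp.

Set Implicit Arguments.
Unset Strict Implicit.
Unset Printing Implicit Defensive.

Import GRing.Theory.
Local Open Scope ring_scope.
Local Open Scope quotient_scope.

Notation Pol d := {mpoly 'F_2[d]}.

Lemma mpoly_rmorph_ext d (S : comNzRingType) (f g : {rmorphism Pol d -> S}) :
  (forall i, f 'X_i = g 'X_i) -> f =1 g.
Proof.
move=> fgX p; rewrite (mpolyE p) !rmorph_sum; apply: eq_bigr => m _.
rewrite -mul_mpolyC !rmorphM; congr (_ * _).
  have [->|->] : p@_m = 0 \/ p@_m = 1.
  - by case: (p@_m) => [[|[|//]] H]; [left | right]; apply: val_inj.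
  - by rewrite mpolyC0 !rmorph0.
  - by rewrite mpolyC1 !rmorph1.
rewrite mpolyXE_id !rmorph_prod; apply: eq_bigr => i _.
by rewrite !rmorphXn fgX.
Qed.

(* By the Cartan formula the total square f |-> \sum_k (Sq^k f) t^k is a ring
   morphism Pol d -> (Pol d)[t]; it maps x_i to x_i + x_i^2 t. *)
Definition Sqt d (f : Pol d) : {poly Pol d} :=
  mmap (polyC \o @mpolyC d 'F_2) (fun i => ('X_i)%:P + ('X_i ^+ 2)%:P * 'X) f.

HB.instance Definition _ d := GRing.RMorphism.copy (@Sqt d)
  (mmap (polyC \o @mpolyC d 'F_2) (fun i => ('X_i)%:P + ('X_i ^+ 2)%:P * 'X)).

Definition Sq d (k : nat) (f : Pol d) : Pol d := (Sqt f)`_k.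

Lemma Sqt_X d (i : 'I_d) : Sqt 'X_i = ('X_i)%:P + ('X_i ^+ 2)%:P * 'X.
Proof. by rewrite /Sqt mmapX mmap1U. Qed.

Lemma SqtC d (a : 'F_2) : Sqt (a%:MP : Pol d) = (a%:MP)%:P.
Proof. by rewrite /Sqt mmapC. Qed.

Lemma Sq_is_linear d k : linear (@Sq d k).
Proof.
move=> a f g; rewrite /Sq -mul_mpolyC rmorphD rmorphM coefD; congr (_ + _).
by rewrite /= SqtC coefCM mul_mpolyC.
Qed.

HB.instance Definition _ d k :=
  GRing.isLinear.Build 'F_2 (Pol d) (Pol d) _ (@Sq d k) (@Sq_is_linear d k).

Lemma Sq1_X d (i : 'I_d) : Sq 1 'X_i = 'X_i ^+ 2.
Proof. by rewrite /Sq Sqt_X coefD coefC coefMX coefC /= add0r. Qed.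

Lemma Sq_X d (i : 'I_d) k : (1 < k)%N -> Sq k 'X_i = 0.
Proof.
by case: k => [|[|k]] // _; rewrite /Sq Sqt_X coefD coefC coefMX coefC /= add0r.
Qed.

Lemma Sq_cartan d k (f g : Pol d) :
  Sq k (f * g) = \sum_(i < k.+1) Sq i f * Sq (k - i) g.
Proof. by rewrite /Sq rmorphM coefM. Qed.

Lemma Sq0 d (f : Pol d) : Sq 0 f = f.
Proof.
rewrite /Sq -horner_coef0.
have := @mpoly_rmorph_ext d _ (horner_eval 0 \o @Sqt d) idfun _ f => /=.
apply=> i; rewrite /= Sqt_X /horner_eval.
by rewrite !hornerE.
Qed.

Definition subst_mx d (w : 'M['F_2]_d) (f : Pol d) : Pol d :=
  f \mPo [tuple \sum_(i < d) w i j *: 'X_i | j < d].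

HB.instance Definition _ d w := GRing.LRMorphism.copy (@subst_mx d w)
  (comp_mpoly [tuple \sum_(i < d) w i j *: ('X_i : Pol d) | j < d]).

Lemma subst_mx_X d (w : 'M['F_2]_d) (j : 'I_d) :
  subst_mx w 'X_j = \sum_(i < d) w i j *: 'X_i.
Proof. by rewrite /subst_mx comp_mpolyXU -tnth_nth tnth_mktuple. Qed.

Lemma Sqt_subst d (w : 'M['F_2]_d) (f : Pol d) :
  Sqt (subst_mx w f) = map_poly (subst_mx w) (Sqt f).
Proof.
have := @mpoly_rmorph_ext d _ (@Sqt d \o subst_mx w)
  (map_poly (subst_mx w) \o @Sqt d) _ f.
apply=> j /=.
rewrite Sqt_X rmorphD rmorphM /= map_polyX !map_polyC /= rmorphXn /= !subst_mx_X.
rewrite rmorph_sum /=.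
have chP : 2%N \in [pchar Pol d].
  rewrite inE /=; apply/eqP; rewrite -mpolyC_nat.
  by rewrite (_ : 2%:R = 0 :> 'F_2) ?mpolyC0 //; apply: val_inj.
rewrite -(pFrobenius_autE chP) !rmorph_sum /= mulr_suml -big_split /=.
apply: eq_bigr => i _; rewrite pFrobenius_autE -mul_mpolyC exprMn -rmorphXn /=.
have -> : w i j ^+ 2 = w i j by case: (w i j) => [[|[|//]] ?]; apply: val_inj.
by rewrite rmorphM /= SqtC Sqt_X mulrDr !polyCM !mulrA.
Qed.

Lemma Sq_subst d (w : 'M['F_2]_d) k (f : Pol d) :
  Sq k (subst_mx w f) = subst_mx w (Sq k f).
Proof. by rewrite /Sq Sqt_subst coef_map. Qed.

(* The Steenrod algebra is generated by the Sq^k, k > 0, subject to the Adem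
   relations, which the operations above satisfy. Hence the words
   Sq^k1 ... Sq^kr with all ki > 0 span it linearly, the non-empty ones span
   its augmentation ideal A+, and A+ Pol is the set of finite sums of values of
   non-empty words; scalars in F_2 need not be mentioned. *)
Definition Sq_word d (ks : seq nat) (f : Pol d) : Pol d := foldr (@Sq d) f ks.

Definition aug_word (ks : seq nat) := (ks != [::]) && all (leq 1) ks.

Definition hit d : {pred Pol d} := fun f =>
  `[< exists s : seq (seq nat * Pol d),
        all (fun u => aug_word u.1) s /\ f = \sum_(u <- s) Sq_word u.1 u.2 >].

Lemma Sq_word_is_linear d ks : linear (@Sq_word d ks).
Proof. by move=> a f g; elim: ks => //= k ks ->; rewrite linearP. Qed.

HB.instance Definition _ d ks :=
  GRing.isLinear.Build 'F_2 (Pol d) (Pol d) _ (@Sq_word d ks) (@Sq_word_is_linear d ks).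

Lemma Sq_word_subst d (w : 'M['F_2]_d) ks (f : Pol d) :
  Sq_word ks (subst_mx w f) = subst_mx w (Sq_word ks f).
Proof.
elim: ks => [|k ks IHks]; first exact: erefl.
exact: etrans (congr1 (@Sq d k) IHks) (Sq_subst w k (Sq_word ks f)).
Qed.

Lemma hit_submod_closed d : submod_closed (@hit d).
Proof.
split; first by apply/asboolP; exists [::]; rewrite big_nil.
move=> a f g /asboolP[s [sP ->]] /asboolP[t [tP ->]]; apply/asboolP.
exists ([seq (u.1, a *: u.2) | u <- s] ++ t); split.
  by rewrite all_cat tP andbT all_map.
rewrite big_cat big_map /= scaler_sumr; congr (_ + _).
by apply: eq_bigr => u _; rewrite linearZ.
Qed.

HB.instance Definition _ d :=
  GRing.isSubmodClosed.Build 'F_2 (Pol d) (@hit d) (@hit_submod_closed d).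

Lemma hit_subst d (w : 'M['F_2]_d) (f : Pol d) :
  f \in @hit d -> subst_mx w f \in @hit d.
Proof.
move=> /asboolP[s [sP ->]]; apply/asboolP.
exists [seq (u.1, subst_mx w u.2) | u <- s]; split; first by rewrite all_map.
by rewrite big_map linear_sum; apply: eq_bigr => u _; rewrite /= Sq_word_subst.
Qed.

Lemma hitP d (f : Pol d) :
  reflect (exists (n : nat) (g : nat -> Pol d), f = \sum_(k < n) Sq k.+1 (g k))
          (f \in @hit d).
Proof.
apply: (iffP idP) => [/asboolP[s [sP ->]]|[n [g ->]]]; last first.
  apply/asboolP; exists [seq ([:: k.+1], g k) | k <- iota 0 n]; split.
    by rewrite all_map; apply/allP.
  by rewrite big_map -[n in iota 0 n]subn0 -/(index_iota 0 n) big_mkord.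
elim: s sP => [_|[[|k ks] h] s IHs] /=.
- by exists 0%N, (fun=> 0); rewrite big_nil big_ord0.
- by [].
case/andP=> /andP[_ /andP[k0 _]] /IHs[n [g E]].
exists (maxn k n), (fun j =>
  (if (j < n)%N then g j else 0) + (if j == k.-1 then Sq_word ks h else 0)).
rewrite big_cons E /= addrC.
under [RHS]eq_bigr do rewrite linearD.
rewrite big_split /=; congr (_ + _).
  apply: etrans (big_ord_widen _ (fun j => Sq j.+1 (g j)) (leq_maxr k n)) _.
  rewrite [LHS]big_mkcond.
  by apply: eq_bigr => j _; case: ifP => //; rewrite linear0.
have kn : (k.-1 < maxn k n)%N by rewrite leq_max prednK ?leqnn.
rewrite (bigD1 (Ordinal kn)) //= eqxx prednK // big1 ?addr0 // => j jk.
by rewrite ifN ?linear0.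
Qed.

Definition QP d : Type := Quotient.quot (@hit d).
HB.instance Definition _ d := GRing.Zmodule.on (QP d).

Definition cls d (f : Pol d) : QP d := \pi_(Quotient.quot (@hit d)) f.

Lemma cls_eqP d (f g : Pol d) : reflect (cls f = cls g) (f - g \in @hit d).
Proof. by rewrite Quotient.idealrBE; apply: eqP. Qed.

Definition QPrep d (c : QP d) : Pol d := repr (c : Quotient.quot (@hit d)).

Lemma QPrepK d : cancel (@QPrep d) (@cls d).
Proof. exact: reprK. Qed.

Lemma cls_is_zmod_morphism d : zmod_morphism (@cls d).
Proof. by move=> f g; rewrite /cls !piE. Qed.

HB.instance Definition _ d :=
  GRing.isZmodMorphism.Build (Pol d) (QP d) (@cls d) (@cls_is_zmod_morphism d).

Definition QPscale d (a : 'F_2) (c : QP d) : QP d := cls (a *: QPrep c).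

Lemma QPscale_cls d a (f : Pol d) : QPscale a (cls f) = cls (a *: f).
Proof.
by apply/cls_eqP; rewrite -scalerBr rpredZ //; apply/cls_eqP/QPrepK.
Qed.

Fact QPscaleA d a b (c : QP d) : QPscale a (QPscale b c) = QPscale (a * b) c.
Proof. by rewrite -[c]QPrepK !QPscale_cls scalerA. Qed.

Fact QPscale1 d : left_id 1 (@QPscale d).
Proof. by move=> c; rewrite -[c]QPrepK QPscale_cls scale1r. Qed.

Fact QPscaleDr d : right_distributive (@QPscale d) +%R.
Proof.
move=> a x y; rewrite -[x]QPrepK -[y]QPrepK -raddfD !QPscale_cls -raddfD.
by rewrite scalerDr.
Qed.

Fact QPscaleDl d c : {morph (@QPscale d)^~ c : a b / a + b}.
Proof.
by move=> a b; rewrite -[c]QPrepK !QPscale_cls -raddfD scalerDl.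
Qed.

HB.instance Definition _ d := GRing.Zmodule_isLmodule.Build 'F_2 (QP d)
  (@QPscaleA d) (@QPscale1 d) (@QPscaleDr d) (@QPscaleDl d).

Definition inQP d (n : nat) (c : QP d) : Prop :=
  exists2 f : Pol d, f \is n.-homog & c = cls f.

Definition QPact d (w : 'M['F_2]_d) (c : QP d) : QP d :=
  cls (subst_mx w (QPrep c)).

Lemma QPact_cls d (w : 'M['F_2]_d) (f : Pol d) :
  QPact w (cls f) = cls (subst_mx w f).
Proof.
by apply/cls_eqP; rewrite -raddfB hit_subst //; apply/cls_eqP/QPrepK.
Qed.

(* GL(d, F_2) is taken as the units of 'M_d: the library's type {'GL_d[F_2]} has
   d.-1.+1 as its dimension, which is not convertible to d. *)
Definition QPinv d (n : nat) (c : QP d) : Prop :=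
  inQP n c /\ forall w : 'M['F_2]_d, w \in unitmx -> QPact w c = c.

Definition has_dim (K : fieldType) (V : lmodType K) (W : V -> Prop) (n : nat) :=
  exists b : 'I_n -> V,
    (forall a : 'I_n -> K, \sum_(i < n) a i *: b i = 0 -> forall i, a i = 0) /\
    (forall v, W v <-> exists a : 'I_n -> K, v = \sum_(i < n) a i *: b i).

(* Main.v *)
(* The class is found over an extension L of F_2 containing a root t of
   X^5 + X^4 + X^2 + X + 1, whose conjugates t_i = t^(2^i) form a self-dual normal
   basis of the field with 32 elements. In the coordinates y_i = \sum_j t_(i+j) x_j
   the total square maps y_i to y_i + y_(i-1)^2, a Singer cycle of order 31 scales y_i by t_i, and the
   cyclic permutation of the x_j rotates the y_i. These two generate a group of odd
   order 155, so an invariant class is represented by its average, a combination of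
   the 81 rotation orbits of monomials y^b with \sum_i b_i = 21 and
   31 | \sum_i 2^i b_i. Explicit hit polynomials reduce the 81 orbits to 5. The
   circulant y_i |-> y_i + y_(i+1) + y_(i+2), which together with the two previous
   elements generates GL_5, is then compared with the identity through four
   functionals vanishing on hit polynomials: this leaves one line. Its generator is
   fixed by the circulant modulo an explicit hit polynomial, and a fifth functional
   shows that it is not hit. Everything descends to F_2 through the coordinates of
   L in a basis over F_2. *)
From HB Require Import structures.
Require Import Defs.
From mathcomp Require Import all_boot all_order all_algebra.
From mathcomp Require Import finfield fieldext galois vector.
From mathcomp Require Import mpoly boolp ring zify.

Set Implicit Arguments.
Unset Strict Implicit.
Unset Printing Implicit Defensive.

Import GRing.Theory.
Local Open Scope ring_scope.

(** * Parity tries and binomials modulo 2 *)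

(** [GL_5] has even order, so in characteristic 2 one cannot average over the whole group. Averaging
    is confined to a subgroup of odd order, and the remaining generator is handled by linear algebra
    modulo hits. Scalars are extended because the Singer cycle becomes diagonal over [L], where its
    average merely selects monomials. The normal basis keeps field elements out of the computations:
    the total square, the rotation and the circulant all have coefficients 0 and 1 in the [y_i]. A
    polynomial is therefore handled as a list of exponent vectors counted modulo 2, and every
    certificate is checked by evaluation on such lists. Self-duality makes the change of coordinates
    its own inverse. Since the circulant commutes with the rotation, its effect on an orbit is read
    off from a single monomial. *)

(* Sets of lists of length [n]. As [toggle] removes a list already present,
   [trie_of n s] keeps the members of [s] of odd multiplicity. *)
Fixpoint trie n : Type := if n is n'.+1 then seq (trie n') else bool.

Definition trie0 n : trie n := if n is n'.+1 then [::] else false.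

Fixpoint update T (d : T) (f : T -> T) i (s : seq T) : seq T :=
  match i, s with
  | 0, x :: s' => f x :: s'
  | 0, [::] => [:: f d]
  | i'.+1, x :: s' => x :: update d f i' s'
  | i'.+1, [::] => d :: update d f i' [::]
  end.

Fixpoint toggle n (k : seq nat) : trie n -> trie n :=
  if n is n'.+1 then update (trie0 n') (@toggle n' (behead k)) (head 0%N k)
  else negb.

Fixpoint lookup n (k : seq nat) : trie n -> bool :=
  if n is n'.+1 then
    fun t => @lookup n' (behead k) (nth (trie0 n') t (head 0%N k))
  else fun b => b.

Fixpoint consL T (e : T -> seq (seq nat)) i (t : seq T) : seq (seq nat) :=
  if t is x :: t' then map (cons i) (e x) ++ consL e i.+1 t' else [::].

Fixpoint keys n : trie n -> seq (seq nat) :=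
  if n is n'.+1 then consL (@keys n') 0
  else fun b => if b then [:: [::]] else [::].

Definition trie_of n (s : seq (seq nat)) : trie n :=
  foldr (@toggle n) (trie0 n) s.

Lemma keys_trie0 n : keys (trie0 n) = [::].
Proof. by case: n. Qed.

(** Deleting [k] also amounts to adding [phi k], which is its own opposite. *)
Lemma sum_keys_toggle (V : zmodType) n (phi : seq nat -> V) k (t : trie n) :
  (forall v : V, v + v = 0) -> size k = n ->
  \sum_(m <- keys (toggle k t)) phi m = phi k + \sum_(m <- keys t) phi m.
Proof.
move=> V2; elim: n => [|n IHn] in phi k t *.
  move/size0nil=> ->; case: t => /=; rewrite !big_cons !big_nil !addr0 //.
case: k => // i k [sk] /=.
rewrite -[in RHS](add0n i); elim: i t 0%N => [|i IHi] [|x t] j /=.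
- by rewrite cats0 big_map IHn // keys_trie0 /= !big_nil addn0.

- by rewrite !big_cat !big_map IHn //= addrA addn0.
- by rewrite keys_trie0 IHi /= addSnnS.
- by rewrite !big_cat IHi /= addrCA addSnnS.
Qed.

(** Pairs of equal keys cancel, so passing through a trie is a normal form that preserves sums in
    characteristic 2. *)
Lemma sum_keys (V : zmodType) n (phi : seq nat -> V) s :
  (forall v : V, v + v = 0) -> all (fun m => size m == n) s ->
  \sum_(m <- keys (trie_of n s)) phi m = \sum_(m <- s) phi m.
Proof.
move=> V2; elim: s => [|m s IHs] /=; first by rewrite keys_trie0.
by case/andP=> /eqP sm /IHs IH; rewrite sum_keys_toggle // IH big_cons.
Qed.

Lemma lookup_trie0 n k : lookup k (trie0 n) = false.
Proof. by elim: n k => //= n IHn k; rewrite nth_nil IHn. Qed.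

Lemma nth_update T (d : T) f i s j :
  nth d (update d f i s) j = if j == i then f (nth d s i) else nth d s j.
Proof.
elim: i s j => [|i IHi] [|x s] [|j] //=; rewrite ?nth_nil //.
- by rewrite IHi !nth_nil.
Qed.

Lemma lookup_toggle n m k (t : trie n) : size k = n -> size m = n ->
  lookup k (toggle m t) = (k == m) (+) lookup k t.
Proof.
elim: n k m t => [|n IHn] k m t; first by move=> /size0nil-> /size0nil->; case: t.
case: k m => [//|i k] [//|j m] [sk] [sm] /=; rewrite nth_update eqseq_cons.
by case: eqP => [->|_] //=; rewrite IHn.
Qed.

Lemma lookup_trie_of n k s : size k = n -> all (fun m => size m == n) s ->
  lookup k (trie_of n s) = odd (count_mem k s).
Proof.
move=> sk; elim: s => [|m s IHs] /=; first by rewrite lookup_trie0.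
by case/andP=> /eqP sm /IHs IH; rewrite lookup_toggle // IH oddD oddb eq_sym.
Qed.

(** Pascal's triangle modulo 2, one row from the previous one; [c] carries the entry to the left. *)
Fixpoint pascal_step c (r : seq bool) :=
  if r is x :: r' then c (+) x :: pascal_step x r' else [:: c].

Fixpoint pascal n := if n is n'.+1 then pascal_step false (pascal n') else [:: true].

Lemma nth_pascal n k : nth false (pascal n) k = odd 'C(n, k).
Proof.
have stepE c r j :
    nth false (pascal_step c r) j = nth false (c :: r) j (+) nth false r j.
  by elim: r c j => [|x r IHr] c [|j] //=; rewrite ?nth_nil ?addbF ?IHr.
elim: n k => [|n IHn] [|k] //=; first by rewrite nth_nil.
  by rewrite stepE IHn bin0.
by rewrite stepE /= !IHn binS oddD addbC.
Qed.

Definition odd_bin n := [seq k <- iota 0 n.+1 | nth false (pascal n) k].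

(* The k_i with sum k_i = k for which \prod_i 'C(b_i, k_i) is odd. *)
Fixpoint splits (b : seq nat) k : seq (seq nat) :=
  if b is n :: b' then
    flatten [seq if (i <= k)%N then map (cons i) (splits b' (k - i)%N) else [::]
            | i <- odd_bin n]
  else if k is 0 then [:: [::]] else [::].

Section Char2.
Variables (A : comNzRingType) (A2 : forall v : A, v + v = 0).

Lemma mulrn_odd (v : A) n : v *+ n = v *+ odd n.
Proof. by rewrite -[n in LHS]odd_double_half mulrnDr -mul2n mulrnA mulr2n A2 mul0rn addr0. Qed.

(** The total square of the monomial with exponents [b], when each y has total square y + z T. A
    term of its expansion, with [z_i] chosen [k_i] times, is [mono2]. *)
Fixpoint lin_prod (ys zs : seq A) (b : seq nat) : {poly A} :=
  match ys, zs, b with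
  | y :: ys', z :: zs', n :: b' => (y%:P + z%:P * 'X) ^+ n * lin_prod ys' zs' b'
  | _, _, _ => 1
  end.

Fixpoint mono2 (ys zs : seq A) (b ks : seq nat) : A :=
  match ys, zs, b, ks with
  | y :: ys', z :: zs', n :: b', k :: ks' =>
      y ^+ (n - k)%N * z ^+ k * mono2 ys' zs' b' ks'
  | _, _, _, _ => 1
  end.

(** Binomial expansion of each factor; only the odd binomial coefficients survive, and these are
    what [splits] enumerates. *)
Lemma coef_lin_prod ys zs b k : size ys = size b -> size zs = size b ->
  (lin_prod ys zs b)`_k = \sum_(ks <- splits b k) mono2 ys zs b ks.
Proof.
elim: b ys zs k => [|n b IHb] [|y ys] [|z zs] //= k.
  by case: k => [|k] _ _; rewrite coef1 ?big_nil // big_seq1.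
move=> [sy] [sz]; rewrite exprDn mulr_suml coef_sum.
rewrite big_flatten big_map big_filter big_mkcond.
rewrite -[iota 0 n.+1]/(index_iota 0 n.+1) big_mkord.
apply: eq_bigr => i _; rewrite nth_pascal exprMn -!polyC_exp.
rewrite mulrnAl coefMn mulrn_odd -!mulrA !coefCM coefXnM.
case: odd; last by rewrite mulr0n.
rewrite mulr1n ltnNge; case: leqP => ik /=; last by rewrite !mulr0 big_nil.
rewrite big_map IHb // !mulr_sumr; apply: eq_bigr => ks _.
by rewrite mulrA.
Qed.

End Char2.

(** * A self-dual normal basis of the field with 32 elements *)

Lemma exists_root_F2 (p : {poly 'F_2}) : (1 < size p)%N ->
  exists (L : fieldExtType 'F_2) (t : L), root (map_poly (in_alg L) p) t.
Proof.
move=> p1; have p0 : p != 0 by apply: contraTneq p1 => ->; rewrite size_poly0.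
have [L [rs Dp _]] := FinSplittingFieldFor p0.
exists L; case: rs Dp => [|t rs] Dp.
  by move/eqp_size: Dp; rewrite big_nil size_map_poly size_poly1 => E; rewrite E in p1.
by exists t; rewrite (eqp_root Dp) root_prod_XsubC inE eqxx.
Qed.

Lemma exists_theta : exists (L : fieldExtType 'F_2) (t : L),
  t ^+ 5 + t ^+ 4 + t ^+ 2 + t + 1 = 0.
Proof.
have [|L [t]] := @exists_root_F2 ('X^5 + ('X^4 + 'X^2 + 'X + 1)).
  rewrite size_polyDl size_polyXn //.
  by do !rewrite size_polyDl ?size_polyXn ?size_polyX ?size_poly1 //.
rewrite rootE !rmorphD /= !map_polyXn map_polyX rmorph1 !hornerE => /eqP E.
by exists L, t; exact: E.
Qed.

Lemma F2_cases (c : 'F_2) : c = 0 \/ c = 1.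
Proof. by case: c => [[|[|//]] ?]; [left | right]; apply: val_inj. Qed.

Section Theta.
Variables (L : fieldExtType 'F_2) (t : L).
Hypothesis tE : t ^+ 5 + t ^+ 4 + t ^+ 2 + t + 1 = 0.

(** Stated for modules over [L], so that it serves both [L] itself, as [L^o], and polynomials. *)
Lemma addxx (V : lmodType L) (v : V) : v + v = 0.
Proof.
have L2 : 1 + 1 = 0 :> L.
  by rewrite -[1]scale1r -scalerDl (_ : 1 + 1 = 0 :> 'F_2) ?scale0r //; apply: val_inj.
by rewrite -[v]scale1r -scalerDl L2 scale0r.
Qed.

Lemma oppxx (V : lmodType L) (v : V) : - v = v.
Proof. by apply/eqP; rewrite eq_sym -subr_eq0 opprK addxx. Qed.

Lemma sqrD2 (x y : L) : (x + y) ^+ 2 = x ^+ 2 + y ^+ 2.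
Proof. by rewrite sqrrD mulr2n (addxx (x * y : L^o)) addr0. Qed.

(** A certificate for equality in characteristic 2 modulo the equation of [t]: [q] is the quotient
    by that polynomial and [r] half of the even error, after which [ring] checks an identity with
    integer coefficients. *)
Lemma eq_theta (x y q r : L) :
  x = y + q * (t ^+ 5 + t ^+ 4 + t ^+ 2 + t + 1) + (r + r) -> x = y.
Proof. by move=> ->; rewrite tE mulr0 addr0 (addxx (r : L^o)) addr0. Qed.

Definition th n := t ^+ (2 ^ n).

Lemma thS n : th n.+1 = th n ^+ 2.
Proof. by rewrite /th expnS mulnC exprM. Qed.

Lemma th0 : th 0 = t. Proof. exact: expr1. Qed.
Lemma th1 : th 1 = t ^+ 2. Proof. by rewrite thS th0. Qed.
Lemma th2 : th 2 = t ^+ 4. Proof. by rewrite thS th1 -exprM. Qed.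

Lemma th3 : th 3 = t ^+ 3 + t.
Proof.
rewrite thS th2.
apply: (@eq_theta _ _ (t + t ^+ 2 + t ^+ 3)
  (- t - t ^+ 2 - t ^+ 3 *+ 2 - t ^+ 4 - t ^+ 5 - t ^+ 6 - t ^+ 7)); ring.
Qed.

Lemma th4 : th 4 = t ^+ 4 + t ^+ 3 + t ^+ 2 + 1.
Proof.
rewrite thS th3.
apply: (@eq_theta _ _ (1 + t) (- 1 - t - t ^+ 2 - t ^+ 3 - t ^+ 5)); ring.
Qed.

Lemma th5 : th 5 = t.
Proof.
rewrite thS th4.
apply: (@eq_theta _ _ (1 + t ^+ 2 + t ^+ 3) (- t + t ^+ 6)); ring.
Qed.

Lemma th_period n : th (n + 5) = th n.
Proof. by elim: n => [|n IHn]; rewrite ?th5 ?th0 // addSn !thS IHn. Qed.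

(** The sum is the trace of t_i t_k. It is invariant under squaring, so only the cyclic distance
    between i and k matters, which leaves the three values [T0], [T1] and [T2]. *)
Lemma th_dual (i k : 'I_5) : \sum_(j < 5) th (i + j) * th (j + k) = (i == k)%:R.
Proof.
have T0 : th 0 ^+ 2 + th 1 ^+ 2 + th 2 ^+ 2 + th 3 ^+ 2 + th 4 ^+ 2 = 1.
  rewrite -!thS th5 th1 th2 th3 th4.
  apply: (@eq_theta _ _ 0 (t + t ^+ 2 + t ^+ 3 + t ^+ 4)); ring.
have T1 : th 0 * th 1 + th 1 * th 2 + th 2 * th 3 + th 3 * th 4 + th 4 * th 0 = 0.
  rewrite th0 th1 th2 th3 th4.
  apply: (@eq_theta _ _ 0
    (t + t ^+ 3 *+ 2 + t ^+ 4 + t ^+ 5 *+ 2 + t ^+ 6 + t ^+ 7)); ring.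
have T2 : th 0 * th 2 + th 1 * th 3 + th 2 * th 4 + th 3 * th 0 + th 4 * th 1 = 0.
  rewrite th0 th1 th2 th3 th4.
  apply: (@eq_theta _ _ (t ^+ 3) (t ^+ 2 + t ^+ 4 + t ^+ 5 + t ^+ 6)); ring.
have P n : th n.+4.+1 = th n by rewrite -[RHS]th_period addnC.
rewrite !big_ord_recr big_ord0 -val_eqE /=.
case: i k => i Hi [k Hk] /=; move: i k Hi Hk.
case=> [|[|[|[|[|i]]]]] //; case=> [|[|[|[|[|k]]]]] // _ _;
  rewrite ?addn0 ?addn1 ?addn2 ?addn3 ?addn4 ?P /=.
all: first [rewrite -[RHS]T0; ring | rewrite -[RHS]T1; ring | rewrite -[RHS]T2; ring].
Qed.

(** The multiplication table of the normal basis. Only the case n = 0 is computed; squaring is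
    additive and raises every index by one. *)
Lemma th_mul n : [/\ th n * th n = th n.+1, th n * th n.+1 = th n + th n.+3,
  th n * th n.+2 = th n.+3 + th n.+4, th n * th n.+3 = th n.+1 + th n.+2 &
  th n * th n.+4 = th n.+2 + th n.+4].
Proof.
elim: n => [|n [E0 E1 E2 E3 E4]].
  rewrite th0 th1 th2 th3 th4; split.
  - ring.
  - apply: (@eq_theta _ _ 0 (- t)); ring.
  - apply: (@eq_theta _ _ 1 (- 1 - t - t ^+ 2 - t ^+ 3 - t ^+ 4)); ring.
  - ring.
  - apply: (@eq_theta _ _ 1 (- 1 - t ^+ 2 - t ^+ 4)); ring.
have sq m p q : th n * th m = th p + th q -> th n.+1 * th m.+1 = th p.+1 + th q.+1.
  by move=> E; rewrite thS [th m.+1]thS -exprMn E sqrD2 -!thS.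
by split; [rewrite -expr2 -thS | exact: sq..].
Qed.

Lemma th_expr31 : t ^+ 31 = 1.
Proof.
have t0 : t != 0.
  by apply: contra_eq_neq tE => ->; rewrite !expr0n /= !add0r oner_neq0.
by apply: (mulfI t0); rewrite -exprS mulr1 -[RHS]th5; congr (_ ^+ _).
Qed.

(** The factor by which the Singer average multiplies a monomial of weight [w]. The order of [t] is
    exactly 31, since 31 is prime and t = 1 would turn the equation into 1 = 0. The geometric sum
    thus vanishes unless 31 divides [w], when it is 31 = 1. *)
Lemma sum_th_pow w : \sum_(j < 31) (t ^+ w) ^+ j = (31 %| w)%:R.
Proof.
have /prim_order_exists[//|m tm m31] := th_expr31.
have {m m31} tm : 31.-primitive_root t.
  have /primeP[_ /(_ _ m31)] : prime 31 by [].
  case/orP=> /eqP Em; rewrite Em in tm => //.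
  have t1 : t = 1 by rewrite -[LHS]expr1 (prim_expr_order tm).
  have /eqP := tE; rewrite t1 !expr1n.
  by rewrite (addxx (1 : L^o)) add0r (addxx (1 : L^o)) add0r oner_eq0.
rewrite (prim_order_dvd tm); have [-> | tw] := eqVneq (t ^+ w) 1.
  under eq_bigr do rewrite expr1n.
  by rewrite sumr_const card_ord (mulrn_odd (fun v : L => addxx (v : L^o))).
have w31 : (t ^+ w) ^+ 31 = 1 by rewrite exprAC th_expr31 expr1n.
have /eqP := subrX1 (t ^+ w) 31; rewrite w31 subrr eq_sym mulf_eq0 subr_eq0.
by rewrite (negPf tw) => /eqP.
Qed.
End Theta.

(** * Extension of scalars *)

Section Scalars.
Variable (L : fieldExtType 'F_2).

Definition SqtL (h : {mpoly L[5]}) : {poly {mpoly L[5]}} :=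
  mmap (polyC \o @mpolyC 5 L) (fun i => ('X_i)%:P + ('X_i ^+ 2)%:P * 'X) h.

HB.instance Definition _ := GRing.RMorphism.copy SqtL
  (mmap (polyC \o @mpolyC 5 L) (fun i => ('X_i)%:P + ('X_i ^+ 2)%:P * 'X)).

Definition SqL k (h : {mpoly L[5]}) : {mpoly L[5]} := (SqtL h)`_k.

Lemma SqL_is_linear k : linear (SqL k).
Proof.
move=> c f g; rewrite /SqL -mul_mpolyC rmorphD rmorphM coefD; congr (_ + _).
by rewrite /= {1}/SqtL mmapC coefCM mul_mpolyC.
Qed.

HB.instance Definition _ k :=
  GRing.isLinear.Build L {mpoly L[5]} {mpoly L[5]} _ (SqL k) (SqL_is_linear k).

Lemma SqLZ k c h : SqL k (c *: h) = c *: SqL k h.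
Proof. exact: linearZ. Qed.

Definition embed : Pol 5 -> {mpoly L[5]} := map_mpoly (in_alg L).

HB.instance Definition _ := GRing.RMorphism.copy embed (map_mpoly (in_alg L)).

Lemma embedX m : embed 'X_[m] = 'X_[m].
Proof. exact: map_mpolyX. Qed.

Lemma embedZ (c : 'F_2) f : embed (c *: f) = c%:A *: embed f.
Proof. exact: map_mpolyZ. Qed.

Definition substL (w : 'M['F_2]_5) (h : {mpoly L[5]}) : {mpoly L[5]} :=
  h \mPo [tuple embed (\sum_(i < 5) w i j *: 'X_i) | j < 5].

HB.instance Definition _ w := GRing.LRMorphism.copy (substL w)
  (comp_mpoly [tuple embed (\sum_(i < 5) w i j *: 'X_i) | j < 5]).

Lemma substLZ w c h : substL w (c *: h) = c *: substL w h.
Proof. exact: linearZ. Qed.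

Lemma substL_X w (j : 'I_5) : substL w 'X_j = \sum_(i < 5) (w i j)%:A *: 'X_i.
Proof.
rewrite /substL comp_mpolyXU -tnth_nth tnth_mktuple rmorph_sum /=.
by apply: eq_bigr => i _; rewrite embedZ embedX.
Qed.

Lemma embed_Sq k f : embed (Sq k f) = SqL k (embed f).
Proof.
have := @mpoly_rmorph_ext 5 _ (map_poly embed \o @Sqt 5) (SqtL \o embed) _ f.
rewrite /SqL /= => <- => [|i /=]; first by rewrite coef_map.
rewrite Sqt_X rmorphD rmorphM /= map_polyX !map_polyC /= rmorphXn /= !embedX.
by rewrite /SqtL mmapX mmap1U.
Qed.

Lemma embed_subst w f : embed (subst_mx w f) = substL w (embed f).
Proof.
have := @mpoly_rmorph_ext 5 _ (embed \o subst_mx w) (substL w \o embed) _ f.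
apply=> j /=; rewrite subst_mx_X embedX substL_X rmorph_sum /=.
by apply: eq_bigr => i _; rewrite embedZ embedX.
Qed.

(** Polynomials over [L] are sums of scalars times images of [embed], so identities known over F_2
    lift to [L] by being checked there. *)
Lemma eq_on_embed (V : zmodType) (phi psi : {additive {mpoly L[5]} -> V}) :
  (forall c f, phi (c *: embed f) = psi (c *: embed f)) -> phi =1 psi.
Proof.
move=> E h; rewrite (mpolyE h) !raddf_sum; apply: eq_bigr => m _.
by rewrite -embedX E.
Qed.

Lemma SqL_subst w k h : SqL k (substL w h) = substL w (SqL k h).
Proof.
move: h; apply: (@eq_on_embed _ (SqL k \o substL w) (substL w \o SqL k)) => c f.
by rewrite /= substLZ !SqLZ substLZ -embed_Sq -!embed_subst -embed_Sq Sq_subst.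
Qed.

Definition coordL i (v : L) : 'F_2 := coord (vbasis {:L}) i v.

Lemma coordL_is_additive i : zmod_morphism (coordL i).
Proof. by move=> u v; rewrite /coordL linearB. Qed.

HB.instance Definition _ i :=
  GRing.isZmodMorphism.Build L 'F_2 (coordL i) (coordL_is_additive i).

Lemma coordLZ i c v : coordL i (c *: v) = c * coordL i v.
Proof. by rewrite /coordL linearZ. Qed.

Lemma coordL_sum v : v = \sum_i coordL i v *: (vbasis {:L})`_i.
Proof. exact/coord_vbasis/memvf. Qed.

Definition component i : {mpoly L[5]} -> Pol 5 := map_mpoly (coordL i).

HB.instance Definition _ i := GRing.Additive.copy (component i) (map_mpoly (coordL i)).

Lemma component_embed i c f : component i (c *: embed f) = coordL i c *: f.
Proof.
apply/mpolyP => m; rewrite mcoeff_map_mpoly !mcoeffZ mcoeff_map_mpoly /=.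
by rewrite mulr_algr coordLZ mulrC.
Qed.

Lemma componentE h : h = \sum_(i < \dim {:L}) (vbasis {:L})`_i *: embed (component i h).
Proof.
apply/mpolyP => m; rewrite raddf_sum {1}[h@_m]coordL_sum; apply: eq_bigr => i _.
by rewrite /= mcoeffZ !mcoeff_map_mpoly /= mulr_algr.
Qed.

(** The squares are defined over F_2, hence act on each coordinate separately. *)
Lemma component_Sq i k h : component i (SqL k h) = Sq k (component i h).
Proof.
move: h; apply: (@eq_on_embed _ (component i \o SqL k) (Sq k \o component i)) => c f /=.
by rewrite SqLZ -embed_Sq !component_embed linearZ.
Qed.

Lemma component_subst i w h : component i (substL w h) = subst_mx w (component i h).
Proof.
move: h; apply: (@eq_on_embed _ (component i \o substL w) (subst_mx w \o component i)) => c f /=.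
by rewrite substLZ -embed_subst !component_embed linearZ.
Qed.

(** Some coordinate of 1 is non-zero, hence equal to 1 in F_2; the corresponding component is a left
    inverse of [embed]. *)
Lemma exists_retraction : exists i, forall f, component i (embed f) = f.
Proof.
have [i i1] : exists i, coordL i 1 != 0.
  apply/existsP; apply: contraT => /existsPn c0; case/eqP: (oner_neq0 L).
  rewrite [LHS]coordL_sum big1 // => i _.
  by move/negPn/eqP: (c0 i) => ->; rewrite scale0r.
exists i => f; rewrite -[embed f]scale1r component_embed.
have [c0|->] := F2_cases (coordL i 1); last by rewrite scale1r.
by case/eqP: i1.
Qed.

(** The description that [hitP] gives of [hit], over [L]; being inductive, it makes each closure
    property a short induction. *)
Inductive hitL : {mpoly L[5]} -> Prop :=
| hitL0 : hitL 0
| hitLD h k g : hitL h -> hitL (SqL k.+1 g + h).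

Lemma hitL_add f g : hitL f -> hitL g -> hitL (f + g).
Proof. by move=> Hf Hg; elim: Hf => [|h k g' _ IH]; rewrite ?add0r // -addrA; apply: hitLD. Qed.

(** Covers scalar multiples, linear substitutions and cyclic sums at once. *)
Lemma hitL_linear (phi : {additive {mpoly L[5]} -> {mpoly L[5]}}) :
  (forall k g, phi (SqL k g) = SqL k (phi g)) -> forall h, hitL h -> hitL (phi h).
Proof.
move=> E h; elim=> [|h' k g _ IH]; rewrite ?raddf0 ?raddfD /= ?E; first exact: hitL0.
exact: hitLD.
Qed.

Lemma hitL_scale c h : hitL h -> hitL (c *: h).
Proof.
by apply: (@hitL_linear ( *:%R c)) => k g; rewrite linearZ.
Qed.

Lemma hitL_subst w h : hitL h -> hitL (substL w h).
Proof. by apply: hitL_linear => k g; rewrite SqL_subst. Qed.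

Lemma hitL_Sq k g : (0 < k)%N -> hitL (SqL k g).
Proof. by case: k => // k _; rewrite -[SqL _ _]addr0; apply/hitLD/hitL0. Qed.

Lemma hitL_sum I (r : seq I) (F : I -> {mpoly L[5]}) :
  (forall i, hitL (F i)) -> hitL (\sum_(i <- r) F i).
Proof.
by move=> HF; elim/big_ind: _ => //; [exact: hitL0 | exact: hitL_add].
Qed.

Lemma hitL_embed f : f \in @hit 5 -> hitL (embed f).
Proof.
case/hitP=> n [g ->]; rewrite rmorph_sum; apply: hitL_sum => k.
by rewrite /= embed_Sq; apply: hitL_Sq.
Qed.

Lemma hitL_component i h : hitL h -> component i h \in @hit 5.
Proof.
elim=> [|h' k g _ IH]; first by rewrite raddf0 rpred0.
rewrite raddfD /= component_Sq rpredD //; apply/asboolP.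
by exists [:: ([:: k.+1], component i g)]; rewrite big_seq1.
Qed.

End Scalars.

(** * Eigen-coordinates of the Singer cycle *)

(* From y_i^(b_i) comes y_i^(b_i - k_i) y_(i-1)^(2 k_i). *)
Definition target (b ks : seq nat) : seq nat :=
  [seq (u.1.1 - u.1.2 + (u.2 + u.2))%N | u <- zip (zip b ks) (rot 1 ks)].

Definition sq_terms k (b : seq nat) : seq (seq nat) :=
  [seq target b ks | ks <- splits b k].

Lemma size_splits b k : all (fun ks => size ks == size b) (splits b k).
Proof.
elim: b k => [|n b IHb] k /=; first by case: k.
apply/allP => ks /flattenP[s /mapP[i _ ->]]; case: ifP => // _.
by case/mapP=> ks' /(allP (IHb _)) /eqP sk -> /=; rewrite sk.
Qed.

Section Eigen.
Variables (L : fieldExtType 'F_2) (t : L).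
Hypothesis tE : t ^+ 5 + t ^+ 4 + t ^+ 2 + t + 1 = 0.
Local Notation th := (th t).

Definition yv i : {mpoly L[5]} := \sum_(j < 5) th (i + j) *: 'X_j.

Definition ymon (b : seq nat) : {mpoly L[5]} := \prod_(i < 5) yv i ^+ nth 0%N b i.

Lemma yv_period i : yv (i + 5) = yv i.
Proof. by apply: eq_bigr => j _; rewrite addnAC th_period. Qed.

Lemma AA2 (v : {mpoly L[5]}) : v + v = 0.
Proof. exact: (addxx (v : {mpoly L[5]})). Qed.

Lemma sqrD2A (x y : {mpoly L[5]}) : (x + y) ^+ 2 = x ^+ 2 + y ^+ 2.
Proof. by rewrite sqrrD mulr2n AA2 addr0. Qed.

Lemma sqr_sum2 I (r : seq I) (F : I -> {mpoly L[5]}) :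
  (\sum_(i <- r) F i) ^+ 2 = \sum_(i <- r) F i ^+ 2.
Proof. by apply: (big_morph (fun x => x ^+ 2) sqrD2A); rewrite expr0n. Qed.

(** Squaring is additive and sends t_(i-1+j) to t_(i+j), so y_(i-1)^2 = \sum_j t_(i+j) x_j^2, which
    is Sq^1 y_i. The index [i + 4] stands for i - 1. *)
Lemma SqtL_yv i : SqtL (yv i) = (yv i)%:P + (yv (i + 4) ^+ 2)%:P * 'X.
Proof.
rewrite /yv sqr_sum2 !rmorph_sum mulr_suml -big_split; apply: eq_bigr => j _ /=.
rewrite -mul_mpolyC rmorphM /= {1 2}/SqtL mmapC mmapX mmap1U /=.
rewrite mulrDr -polyCM mulrA -polyCM; congr (_%:P + _%:P * _).
rewrite -[th (i + j)]th_period // -addnA [(j + 5)%N]addnC [(5 + j)%N]addSn addnS thS addnA.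
by rewrite mul_mpolyC exprZn.
Qed.

(** This turns Steenrod squares into computations on lists: in the monomials in y every coefficient
    is 0 or 1. *)
Lemma SqL_ymon k b : size b = 5%N ->
  SqL k (ymon b) = \sum_(m <- sq_terms k b) ymon m.
Proof.
case: b => [|b0 [|b1 [|b2 [|b3 [|b4 []]]]]] // _; rewrite /SqL /ymon.
rewrite rmorph_prod /= !big_ord_recl big_ord0 /= !rmorphXn /= !SqtL_yv /=.
set ys := [:: yv 0; yv 1; yv 2; yv 3; yv 4].
set zs := [:: yv 4 ^+ 2; yv 0 ^+ 2; yv 1 ^+ 2; yv 2 ^+ 2; yv 3 ^+ 2].
have P n : yv n.+4.+1 = yv n by rewrite -[RHS]yv_period addnC.
rewrite /bump /= !add1n !addSn !add0n !P.
transitivity (lin_prod ys zs [:: b0; b1; b2; b3; b4])`_k; first by [].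
rewrite coef_lin_prod //; last exact: AA2.
rewrite /sq_terms big_map; apply: eq_big_seq => ks.
move=> /(allP (size_splits _ _)).
case: ks => [|k0 [|k1 [|k2 [|k3 [|k4 []]]]]] //= _.
rewrite !big_ord_recl big_ord0 /= /bump /= !exprD -!exprM !mul2n -!addnn.
rewrite !exprD; ring.
Qed.

Lemma ymonX (m : 'X_{1..5}) : ymon m = 'X_[m] \mPo [tuple yv i | i < 5].
Proof.
rewrite comp_mpolyX; apply: eq_bigr => i _.
by rewrite tnth_mktuple -tnth_nth.
Qed.

(** Substitution of y_i for x_i. The matrix t_(i+j) is its own inverse, so this is an involution,
    and the coefficients of [yco h] are those of [h] in the monomials in y. *)
Definition yco (h : {mpoly L[5]}) := h \mPo [tuple yv i | i < 5].

HB.instance Definition _ := GRing.LRMorphism.copy yco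
  (comp_mpoly [tuple yv i | i < 5]).

Lemma yco_X (i : 'I_5) : yco 'X_i = yv i.
Proof. by rewrite /yco comp_mpolyXU -tnth_nth tnth_mktuple. Qed.

Lemma yco_yv (i : 'I_5) : yco (yv i) = 'X_i.
Proof.
rewrite /yv raddf_sum /=.
under eq_bigr => j _ do rewrite linearZ /= yco_X scaler_sumr.
rewrite exchange_big (bigD1 i) //= [X in _ + X]big1 => [|k ki].
  under eq_bigr do rewrite scalerA.
  by rewrite -scaler_suml th_dual // eqxx scale1r addr0.
under eq_bigr do rewrite scalerA.
by rewrite -scaler_suml th_dual // eq_sym (negPf ki) scale0r.
Qed.

Lemma ycoK : involutive yco.
Proof.
move=> h; rewrite {2}/yco comp_mpolyE raddf_sum [RHS]mpolyE.
apply: eq_bigr => m _; rewrite /= linearZ /= rmorph_prod mpolyXE_id /=.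
congr (_ *: _); apply: eq_bigr => i _.
by rewrite tnth_mktuple rmorphXn /= yco_yv.
Qed.

Lemma ymon_span h : h = \sum_(m <- msupp (yco h)) (yco h)@_m *: ymon m.
Proof.
rewrite -[LHS]ycoK {1}/yco comp_mpolyE; apply: eq_bigr => m _.
by rewrite ymonX comp_mpolyX.
Qed.

End Eigen.

Lemma size_keys n (t : trie n) : all (fun m => size m == n) (keys t).
Proof.
elim: n t => [|n IHn] t /=; first by case: t.
elim: t 0%N => //= x t IHt j; rewrite all_cat IHt andbT.
by apply/allP => _ /mapP[m /(allP (IHn x)) /eqP sm ->] /=; rewrite sm.
Qed.

(** * Generating matrices and their action on monomials *)

Definition mx_of (rows : seq (seq nat)) : 'M['F_2]_5 :=
  \matrix_(i, j) (nth 0%N (nth [::] rows i) j)%:R.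

(* Multiplication by t in the self-dual normal basis, a symmetric matrix. *)
Definition singer := [:: [:: 0; 1; 0; 0; 0]; [:: 1; 0; 0; 1; 0]; [:: 0; 0; 0; 1; 1];
  [:: 0; 1; 1; 0; 0]; [:: 0; 0; 1; 0; 1]]%N.

Definition cshift := [:: [:: 0; 0; 0; 0; 1]; [:: 1; 0; 0; 0; 0]; [:: 0; 1; 0; 0; 0];
  [:: 0; 0; 1; 0; 0]; [:: 0; 0; 0; 1; 0]]%N.

Definition circ := [:: [:: 1; 1; 1; 0; 0]; [:: 0; 1; 1; 1; 0]; [:: 0; 0; 1; 1; 1];
  [:: 1; 0; 0; 1; 1]; [:: 1; 1; 0; 0; 1]]%N.

Definition wt (b : seq nat) := (\sum_(i < 5) 2 ^ i * nth 0 b i)%N.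

Definition incr_at i d (m : seq nat) := set_nth 0%N m i (nth 0 m i + d)%N.

(** A pair (i, j) stands for the factor y_i^(2^j). Exponents are split into binary digits because
    2^j-th powers are additive, so the circulant sends such a factor to three terms only. *)
Definition mon_of (st : seq (nat * nat)) : seq nat :=
  foldr (fun u => incr_at u.1 (2 ^ u.2)%N) (nseq 5 0%N) st.

(** Multiplication by (y_i + y_(i+1) + y_(i+2))^(2^j). Equal monomials are cancelled after each
    factor, so that the list need not triple every time. *)
Definition circ_step (u : nat * nat) (s : seq (seq nat)) : seq (seq nat) :=
  keys (trie_of 5 (flatten
    [seq [seq incr_at ((u.1 + j) %% 5)%N (2 ^ u.2)%N m | j <- [:: 0; 1; 2]%N] | m <- s])).

Definition circ_terms (st : seq (nat * nat)) : seq (seq nat) :=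
  foldr circ_step [:: nseq 5 0%N] st.

Section Action.
Variables (L : fieldExtType 'F_2) (t : L).
Hypothesis tE : t ^+ 5 + t ^+ 4 + t ^+ 2 + t + 1 = 0.
Local Notation th := (th t).
Local Notation yv := (yv t).
Local Notation ymon := (ymon t).

Lemma substL_yv w i : substL w (yv i) =
  \sum_(k < 5) (\sum_(j < 5) w k j *: th (i + j)) *: 'X_k.
Proof.
rewrite /yv raddf_sum /=.
under eq_bigr => j _ do rewrite substLZ substL_X scaler_sumr.
rewrite exchange_big; apply: eq_bigr => k _.
rewrite scaler_suml; apply: eq_bigr => j _.
by rewrite scalerA mulr_algr.
Qed.

Lemma th_mod n : th (n %% 5) = th n.
Proof.
rewrite {2}(divn_eq n 5); elim: (n %/ 5)%N => [|k IHk]; first by rewrite add0n.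
by rewrite mulSn -addnA [(5 + _)%N]addnC th_period.
Qed.

Lemma yv_mod n : yv (n %% 5) = yv n.
Proof.
by apply: eq_bigr => j _; rewrite -[in LHS]th_mod modnDml th_mod.
Qed.

(** In the coefficient of x_k, row k of [singer] combines the t_(i+j) into t_i t_(i+k), by the table
    [th_mul]. *)
Lemma singer_yv i : substL (mx_of singer) (yv i) = th i *: yv i.
Proof.
have P n : th n.+4.+1 = th n by rewrite -[RHS](th_period tE) addnC.
rewrite substL_yv /yv scaler_sumr; apply: eq_bigr => k _.
rewrite scalerA; congr (_ *: _).
have [E0 E1 E2 E3 E4] := th_mul tE i.
rewrite !big_ord_recr big_ord0 !mxE /=.
case: k => -[|[|[|[|[|k]]]]] //= _;
  rewrite ?scale0r ?scale1r ?addr0 ?add0r ?addn0 ?addn1 ?addn2 ?addn3 ?addn4.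
all: by rewrite ?E0 ?E1 ?E2 ?E3 ?E4.
Qed.

Lemma cshift_yv i : substL (mx_of cshift) (yv i) = yv (i + 4).
Proof.
have P n : th n.+4.+1 = th n by rewrite -[RHS](th_period tE) addnC.
rewrite substL_yv; apply: eq_bigr => k _; congr (_ *: _).
rewrite !big_ord_recr big_ord0 !mxE /=.
case: k => -[|[|[|[|[|k]]]]] //= _;
  rewrite ?scale0r ?scale1r ?addr0 ?add0r ?addn0 ?addn1 ?addn2 ?addn3 ?addn4 //.
all: by rewrite ?addSn ?addn4 ?P.
Qed.

Lemma circ_yv i : substL (mx_of circ) (yv i) = yv i + yv i.+1 + yv i.+2.
Proof.
have P n : th n.+4.+1 = th n by rewrite -[RHS](th_period tE) addnC.
rewrite substL_yv -!big_split; apply: eq_bigr => k _; rewrite /= -!scalerDl.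
congr (_ *: _); rewrite !big_ord_recr big_ord0 !mxE /=.
case: k => -[|[|[|[|[|k]]]]] //= _;
  rewrite ?scale0r ?scale1r ?addr0 ?add0r ?addn0 ?addn1 ?addn2 ?addn3 ?addn4 ?addSn;
  rewrite ?addn0 ?addn1 ?addn2 ?addn3 ?addn4 ?P //.
all: ring.
Qed.

Lemma singer_ymon j b :
  iter j (substL (mx_of singer)) (ymon b) = (t ^+ wt b) ^+ j *: ymon b.
Proof.
elim: j => [|j IHj]; first by rewrite scale1r.
rewrite iterS IHj substLZ exprSr -scalerA; congr (_ *: _).
rewrite rmorph_prod /=; under eq_bigr do rewrite rmorphXn /= singer_yv exprZn.
rewrite scaler_prod; congr (_ *: _).
by rewrite /wt -prodrXr; apply: eq_bigr => i _; rewrite exprM.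
Qed.

Lemma cshift_ymon b : size b = 5%N -> substL (mx_of cshift) (ymon b) = ymon (rot 1 b).
Proof.
have P n : yv n.+4.+1 = yv n by rewrite -[RHS](yv_period tE) addnC.
case: b => [|b0 [|b1 [|b2 [|b3 [|b4 []]]]]] // _.
rewrite rmorph_prod !big_ord_recr big_ord0 /=.
rewrite !rmorphXn /= !cshift_yv !addn4 !P /= /ymon !big_ord_recr big_ord0 /=.
ring.
Qed.

Lemma ymon_incr i d m : (i < 5)%N -> ymon (incr_at i d m) = ymon m * yv i ^+ d.
Proof.
move=> i5; rewrite /ymon (bigD1 (Ordinal i5)) //= [in RHS](bigD1 (Ordinal i5)) //=.
rewrite nth_set_nth /= eqxx exprD -!mulrA; congr (_ * _); rewrite mulrC.
congr (_ * _); apply: eq_bigr => j ji; rewrite nth_set_nth /= ifN //.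
Qed.

Lemma ymon_nseq0 : ymon (nseq 5 0%N) = 1.
Proof. by rewrite /ymon big1 // => i _; rewrite nth_nseq if_same. Qed.

Lemma ymon_mon_of st : all (fun u => u.1 < 5)%N st ->
  ymon (mon_of st) = \prod_(u <- st) yv u.1 ^+ (2 ^ u.2).
Proof.
elim: st => [|u st IHst] /=; first by rewrite big_nil ymon_nseq0.
by case/andP=> u5 /IHst IH; rewrite ymon_incr // IH big_cons mulrC.
Qed.

Lemma size_incr i d m : (i < 5)%N -> size m == 5%N -> size (incr_at i d m) == 5%N.
Proof. by move=> i5 /eqP sm; rewrite size_set_nth sm; apply/eqP/maxn_idPr. Qed.

Lemma circ_terms_size st : all (fun m => size m == 5%N) (circ_terms st).
Proof. by case: st => //= u st; apply: size_keys. Qed.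

Lemma sqr_pow2 (x y : {mpoly L[5]}) n :
  (x + y) ^+ (2 ^ n) = x ^+ (2 ^ n) + y ^+ (2 ^ n).
Proof. by elim: n => [|n IHn]; rewrite ?expr1 // expnS mulnC !exprM IHn sqrD2A. Qed.

Lemma circ_termsE st : all (fun u => u.1 < 5)%N st ->
  \sum_(m <- circ_terms st) ymon m = substL (mx_of circ) (ymon (mon_of st)).
Proof.
move=> st5; rewrite ymon_mon_of // rmorph_prod /=.
elim: st st5 => [|u st IHst] /=; first by rewrite big_nil big_seq1 ymon_nseq0.
case/andP=> u5 /IHst IH; rewrite big_cons -IH /circ_step.
rewrite sum_keys; first last.
- apply/allP => m' /flattenP[s /mapP[m /(allP (circ_terms_size st)) sm ->]].
  by case/mapP=> j _ ->; rewrite size_incr // ltn_mod.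
- exact: AA2.
rewrite big_flatten big_map mulr_sumr; apply: eq_bigr => m _.
rewrite big_map !big_cons big_nil !ymon_incr ?ltn_mod // !yv_mod.
rewrite rmorphXn /= circ_yv !sqr_pow2 addn0 addn1 addn2; ring.
Qed.

End Action.

(** * Functionals vanishing on hit polynomials *)

Fixpoint box (s : seq nat) : seq (seq nat) :=
  if s is n :: s' then flatten [seq map (cons i) (box s') | i <- iota 0 n.+1]
  else [:: [::]].

Lemma mem_box s r : size r = size s ->
  (forall i, (nth 0 r i <= nth 0 s i)%N) -> r \in box s.
Proof.
elim: s r => [|n s IHs] [|x r] // [sr] le_rs.
rewrite -[box _]/(flatten [seq map (cons i) (box s) | i <- iota 0 n.+1]).
apply/flattenP; exists (map (cons x) (box s)).
  by apply/mapP; exists x; rewrite // mem_iota ltnS (le_rs 0%N).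
by rewrite map_f // IHs // => i; apply: (le_rs i.+1)%N.
Qed.

(* The pairs (k, b) for which y^m can occur in Sq^k y^b; [q] is the rotated k_i. *)
Definition sources (m : seq nat) : seq (nat * seq nat) :=
  [seq (sumn q, [seq (u.1.1 - (u.1.2 + u.1.2) + u.2)%N | u <- zip (zip m q) (rotr 1 q)])
  | q <- box (map half m)].

Lemma nth_splits b k ks i : ks \in splits b k -> (nth 0 ks i <= nth 0 b i)%N.
Proof.
elim: b k ks i => [|n b IHb] k ks i /=.
  by case: k => // /[!inE] /eqP ->; rewrite nth_nil.
case/flattenP=> s /mapP[j]; rewrite mem_filter mem_iota ltnS => /andP[_ jn] ->.
case: ifP => // _ /mapP[ks' ks'P ->]; case: i => [|i] //=; exact: IHb ks'P.
Qed.

Lemma sumn_splits b k ks : ks \in splits b k -> sumn ks = k.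
Proof.
elim: b k ks => [|n b IHb] k ks /=.
  by case: k => // /[!inE] /eqP ->.
case/flattenP=> s /mapP[j _ ->]; case: ifP => // jk /mapP[ks' /IHb E ->] /=.
by rewrite E subnKC.
Qed.

(** Solve m_i = b_i - k_i + 2 k_(i+1) for b. With q_i = k_(i+1), one has 2 q_i <= m_i, hence the box
    of halves, and b_i = m_i - 2 q_i + k_i. *)
Lemma mem_sources k b m : size b = 5%N -> m \in sq_terms k b -> (k, b) \in sources m.
Proof.
move=> b5 /mapP[ks ksP ->]; have /eqP ks5 := allP (size_splits b k) _ ksP.
have le_ks i := nth_splits i ksP.
have -> : k = sumn (rot 1 ks).
  by rewrite -(sumn_splits ksP); apply/esym/perm_sumn; rewrite perm_rot.
rewrite b5 in ks5; apply/mapP; exists (rot 1 ks).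
  apply: mem_box => [|i]; first by rewrite size_rot !size_map !size_zip size_rot b5 ks5.
  have := le_ks i.
  case: b ks b5 ks5 {ksP le_ks} =>
    [|b0 [|b1 [|b2 [|b3 [|b4 []]]]]] // [|k0 [|k1 [|k2 [|k3 [|k4 []]]]]] // _ _.
  by case: i => [|[|[|[|[|i]]]]] //=; rewrite ?nth_nil // addnn => _; rewrite geq_half_double leq_addl.
congr (_, _); have := (le_ks 0, le_ks 1, le_ks 2, le_ks 3, le_ks 4).
case: b ks b5 ks5 {ksP le_ks} =>
  [|b0 [|b1 [|b2 [|b3 [|b4 []]]]]] // [|k0 [|k1 [|k2 [|k3 [|k4 []]]]]] // _ _ /=.
by case=> -[[[l0 l1] l2] l3] l4; rewrite !addnK !subnK.
Qed.

(** A finite test for vanishing on all hits: if [F] is non-zero on Sq^k y^b, then y^b is a source of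
    some monomial of [F], so only the sources are inspected. *)
Definition kills (F : seq (seq nat)) : bool :=
  all (fun m => size m == 5%N) F &&
  all (fun u => (u.1 == 0%N) || ~~ odd (count (fun m => @lookup 5 m (trie_of 5 F))
                                        (sq_terms u.1 u.2)))
    (flatten (map sources F)).

Section Functional.
Variables (L : fieldExtType 'F_2) (t : L).
Hypothesis tE : t ^+ 5 + t ^+ 4 + t ^+ 2 + t + 1 = 0.
Local Notation ymon := (ymon t).
Local Notation yco := (yco t).

Definition mnm_of (m : seq nat) : 'X_{1..5} := [multinom nth 0%N m i | i < 5].

Lemma mnm_of_inj m m' : size m = 5%N -> size m' = 5%N ->
  (mnm_of m == mnm_of m') = (m == m').
Proof.
move=> sm sm'; apply/eqP/eqP => [E|-> //].
apply: (@eq_from_nth _ 0%N) => [|i]; rewrite sm // => i5.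
by have := congr1 (fun u : 'X_{1..5} => u (Ordinal i5)) E; rewrite !mnmE.
Qed.

(* [F] lists the monomials on which the functional is 1, in the coordinates y. *)
Definition kap (F : seq (seq nat)) (h : {mpoly L[5]}) : L :=
  \sum_(m <- F) (yco h)@_(mnm_of m).

Lemma kap_is_linear F : scalar (kap F).
Proof.
move=> c f g; rewrite /kap mulr_sumr -big_split; apply: eq_bigr => m _.
by rewrite linearP /= mcoeffD mcoeffZ.
Qed.

HB.instance Definition _ F :=
  GRing.isLinear.Build L {mpoly L[5]} L _ (kap F) (kap_is_linear F).

Lemma kap_sum F I (r : seq I) (G : I -> {mpoly L[5]}) :
  kap F (\sum_(i <- r) G i) = \sum_(i <- r) kap F (G i).
Proof. exact: raddf_sum. Qed.

Lemma kapZ F c h : kap F (c *: h) = c * kap F h.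
Proof. exact: linearZ. Qed.

Lemma yco_ymon b : yco (ymon b) = 'X_[mnm_of b].
Proof.
rewrite rmorph_prod mpolyXE_id; apply: eq_bigr => i _.
by rewrite rmorphXn /= yco_yv // mnmE.
Qed.

Lemma kap_ymon F b : all (fun m => size m == 5%N) F -> size b = 5%N ->
  kap F (ymon b) = (@lookup 5 b (trie_of 5 F))%:R.
Proof.
move=> F5 b5; rewrite lookup_trie_of // -(mulrn_odd (fun v : L => addxx (v : L^o))).
rewrite /kap yco_ymon; elim: F F5 => [|m F IHF] /=; first by rewrite big_nil.
case/andP=> /eqP m5 /IHF IH; rewrite big_cons IH mcoeffX mnm_of_inj // natrD.
by rewrite eq_sym.
Qed.

Lemma sum_lookup n (tr : trie n) s :
  \sum_(m <- s) (lookup m tr)%:R = (odd (count (fun m => lookup m tr) s))%:R :> L.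
Proof.
rewrite -(mulrn_odd (fun v : L => addxx (v : L^o))) -natr_sum; congr _%:R.
by rewrite -sumn_count sumnE big_map.
Qed.

Lemma size_target b ks : size b = 5%N -> size ks = 5%N -> size (target b ks) = 5%N.
Proof. by move=> b5 k5; rewrite size_map !size_zip size_rot b5 k5. Qed.

Lemma size_sq_terms k b : size b = 5%N -> all (fun m => size m == 5%N) (sq_terms k b).
Proof.
move=> b5; apply/allP => _ /mapP[ks /(allP (size_splits _ _)) /eqP ks5 ->].
by rewrite size_target // -b5.
Qed.

(** By linearity it suffices to treat Sq^k y^m with k > 0. A value 1 there would need a monomial of
    [F] among the terms, making (k, m) a source, and [kills] has checked that its parity is even. *)
Lemma kap_hit F h : kills F -> hitL h -> kap F h = 0.
Proof.
case/andP=> F5 kF; elim=> [|h' k g _ IH]; first by rewrite raddf0.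
rewrite raddfD /= IH addr0 (ymon_span tE g) [SqL _ _]linear_sum kap_sum.
rewrite big1 // => m _ /=.
have m5 : size m = 5%N by rewrite size_tuple.
rewrite SqLZ kapZ SqL_ymon // kap_sum.
rewrite (eq_big_seq (fun u => (@lookup 5 u (trie_of 5 F))%:R)); last first.
  by move=> u /(allP (size_sq_terms _ m5)) /eqP u5; rewrite kap_ymon.
rewrite sum_lookup; case E: odd; last by rewrite mulr0.
have /hasP[u uS uF] : has (fun u => @lookup 5 u (trie_of 5 F)) (sq_terms k.+1 m).
  by rewrite has_count; case: count E.
have /eqP u5 := allP (size_sq_terms k.+1 m5) _ uS.
have u_in : u \in F.
  by rewrite -has_pred1 has_count; move: uF; rewrite lookup_trie_of //; case: count.
have /(allP kF) /= : (k.+1, val m : seq nat) \in flatten (map sources F).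
  by apply/flattenP; exists (sources u); rewrite ?map_f ?mem_sources.
by rewrite E.
Qed.

End Functional.

(** * Certificates *)

(** The orbits left after elimination, each given by its lexicographically largest rotation, the
    normal form computed by [rot_max]. *)
Definition reps : seq (seq nat) :=
  [::
   [:: 6; 3; 6; 1; 5]; [:: 6; 5; 3; 2; 5]; [:: 7; 3; 6; 3; 2]; [:: 7; 5; 1; 7; 1];
   [:: 7; 5; 3; 4; 2]]%N.

(* For (b, cs), the hit polynomial built from [cs] is the orbit of [b] plus orbits of
   [reps] and of earlier entries. *)
Definition reductions : seq (seq nat * seq (seq nat)) :=
  [::
   ([:: 8; 0; 5; 4; 4], [:: [:: 5; 4; 4; 4; 2]]);
   ([:: 6; 3; 4; 4; 4], [:: [:: 6; 1; 5; 4; 4]]);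
   ([:: 8; 2; 2; 5; 4], [:: [:: 6; 3; 2; 5; 4]]);
   ([:: 8; 2; 4; 2; 5], [:: [:: 6; 3; 4; 2; 5]]);
   ([:: 9; 2; 4; 4; 2], [:: [:: 7; 3; 4; 4; 2]]);
   ([:: 12; 0; 0; 4; 5], [:: [:: 8; 2; 0; 4; 5]]);
   ([:: 10; 1; 0; 6; 4], [:: [:: 10; 1; 0; 4; 5]]);
   ([:: 13; 0; 0; 6; 2], [:: [:: 11; 1; 0; 6; 2]]);
   ([:: 8; 4; 3; 0; 6], [:: [:: 6; 4; 6; 3; 0]]);
   ([:: 7; 2; 0; 6; 6], [:: [:: 6; 6; 5; 3; 0]]);
   ([:: 8; 6; 0; 1; 6], [:: [:: 7; 0; 1; 6; 6]]);
   ([:: 9; 6; 2; 0; 4], [:: [:: 7; 7; 2; 0; 4]]);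
   ([:: 12; 0; 2; 1; 6], [:: [:: 8; 2; 2; 1; 6]]);
   ([:: 10; 1; 4; 0; 6], [:: [:: 10; 1; 2; 1; 6]]);
   ([:: 13; 0; 4; 0; 4], [:: [:: 11; 1; 4; 0; 4]]);
   ([:: 10; 4; 3; 4; 0], [:: [:: 6; 6; 3; 4; 0]]);
   ([:: 8; 7; 2; 4; 0], [:: [:: 8; 5; 3; 4; 0]]);
   ([:: 10; 6; 0; 5; 0], [:: [:: 8; 7; 0; 5; 0]]);
   ([:: 10; 6; 2; 2; 1], [:: [:: 8; 7; 2; 2; 1]]);
   ([:: 12; 1; 4; 4; 0], [:: [:: 8; 3; 4; 4; 0]]);
   ([:: 14; 0; 2; 5; 0], [:: [:: 12; 1; 2; 5; 0]]);
   ([:: 14; 0; 4; 2; 1], [:: [:: 12; 1; 4; 2; 1]]);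
   ([:: 10; 0; 9; 2; 0], [:: [:: 9; 2; 0; 6; 2]]);
   ([:: 8; 3; 8; 2; 0], [:: [:: 9; 2; 0; 8; 1]]);
   ([:: 10; 2; 6; 3; 0], [:: [:: 8; 3; 6; 3; 0]]);
   ([:: 10; 2; 8; 0; 1], [:: [:: 8; 3; 8; 0; 1]]);
   ([:: 10; 8; 1; 0; 2], [:: [:: 10; 1; 0; 2; 6]]);
   ([:: 11; 0; 0; 2; 8], [:: [:: 9; 1; 0; 2; 8]]);
   ([:: 11; 10; 0; 0; 0], [:: [:: 11; 0; 0; 0; 9]]);
   ([:: 12; 5; 2; 0; 2], [:: [:: 8; 7; 2; 0; 2]]);
   ([:: 14; 2; 3; 0; 2], [:: [:: 12; 3; 3; 0; 2]]);
   ([:: 14; 4; 0; 1; 2], [:: [:: 12; 5; 0; 1; 2]]);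
   ([:: 15; 4; 2; 0; 0], [:: [:: 13; 5; 2; 0; 0]]);
   ([:: 11; 1; 0; 8; 1], [:: [:: 8; 1; 3; 5; 0]]);
   ([:: 8; 5; 5; 3; 0], [:: [:: 8; 1; 7; 3; 0]]);
   ([:: 9; 1; 0; 4; 7], [:: [:: 7; 5; 3; 0; 4]]);
   ([:: 9; 1; 2; 1; 8], [:: [:: 8; 1; 5; 2; 1]]);
   ([:: 8; 5; 7; 0; 1], [:: [:: 8; 5; 3; 2; 1]]);
   ([:: 11; 5; 0; 1; 4], [:: [:: 7; 7; 0; 1; 4]]);
   ([:: 16; 1; 1; 1; 2], [:: [:: 8; 5; 1; 1; 2]]);
   ([:: 12; 3; 1; 5; 0], [:: [:: 12; 3; 1; 1; 2]]);
   ([:: 8; 0; 7; 1; 5], [:: [:: 7; 1; 5; 0; 4]]);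
   ([:: 6; 5; 1; 5; 4], [:: [:: 7; 1; 5; 4; 2]]);
   ([:: 8; 4; 1; 3; 5], [:: [:: 6; 1; 3; 5; 4]]);
   ([:: 7; 0; 3; 5; 6], [:: [:: 6; 5; 1; 3; 5]]);
   ([:: 10; 4; 5; 1; 1], [:: [:: 6; 6; 5; 1; 1]]);
   ([:: 8; 7; 4; 1; 1], [:: [:: 8; 5; 5; 1; 1]]);
   ([:: 12; 1; 6; 1; 1], [:: [:: 8; 3; 6; 1; 1]]);
   ([:: 12; 5; 0; 3; 1], [:: [:: 8; 7; 0; 3; 1]]);
   ([:: 9; 0; 9; 0; 3], [:: [:: 9; 0; 1; 4; 3]]);
   ([:: 9; 4; 1; 5; 2], [:: [:: 9; 0; 3; 5; 2]]);
   ([:: 7; 7; 0; 5; 2], [:: [:: 7; 5; 1; 5; 2]]);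
   ([:: 9; 0; 5; 6; 1], [:: [:: 6; 1; 5; 2; 5]]);
   ([:: 7; 3; 4; 6; 1], [:: [:: 7; 1; 5; 6; 1]]);
   ([:: 13; 2; 1; 1; 4], [:: [:: 6; 1; 1; 4; 5]]);
   ([:: 19; 0; 1; 1; 0], [:: [:: 15; 2; 1; 1; 0]]);
   ([:: 17; 1; 3; 0; 0], [:: [:: 9; 5; 3; 0; 0]]);
   ([:: 17; 3; 0; 1; 0], [:: [:: 17; 1; 1; 1; 0]]);
   ([:: 13; 7; 1; 0; 0], [:: [:: 13; 3; 3; 0; 0]]);
   ([:: 9; 6; 0; 3; 3], [:: [:: 7; 5; 1; 3; 3]; [:: 7; 5; 3; 2; 3]]);
   ([:: 7; 7; 2; 2; 3], [:: [:: 7; 7; 0; 3; 3]]);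
   ([:: 9; 4; 3; 2; 3], [:: [:: 7; 5; 3; 2; 3]]);
   ([:: 10; 1; 2; 3; 5], [:: [:: 6; 3; 2; 3; 5]]);
   ([:: 11; 1; 2; 5; 2], [:: [:: 5; 2; 5; 2; 3]]);
   ([:: 9; 0; 7; 3; 2], [:: [:: 7; 3; 2; 5; 2]]);
   ([:: 9; 2; 2; 7; 1], [:: [:: 7; 3; 2; 7; 1]]);
   ([:: 8; 0; 3; 7; 3], [:: [:: 9; 0; 3; 7; 1]]);
   ([:: 9; 2; 6; 1; 3], [:: [:: 7; 3; 6; 1; 3]]);
   ([:: 7; 5; 5; 1; 3], [:: [:: 7; 1; 7; 1; 3]]);
   ([:: 11; 1; 4; 2; 3], [:: [:: 7; 3; 4; 2; 3]]);
   ([:: 13; 0; 2; 3; 3], [:: [:: 11; 1; 2; 3; 3]]);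
   ([:: 14; 2; 1; 3; 1], [:: [:: 6; 6; 1; 3; 1]]);
   ([:: 12; 3; 3; 2; 1], [:: [:: 12; 3; 1; 3; 1]]);
   ([:: 10; 3; 1; 1; 6], [:: [:: 7; 1; 1; 6; 2]]);
   ([:: 11; 3; 3; 0; 4], [:: [:: 11; 3; 1; 1; 4]]);
   ([:: 11; 3; 1; 3; 3], [:: [:: 7; 1; 3; 3; 3]])]%N.

(** This functional takes the value 1 on the invariant class; [functional1] to [functional4] supply
    the linear equations. *)
Definition functional0 : seq (seq nat) :=
  [::
   [:: 0; 5; 2; 7; 7]; [:: 1; 5; 6; 3; 6]; [:: 1; 7; 1; 7; 5]; [:: 1; 7; 5; 1; 7];
   [:: 2; 2; 3; 7; 7]; [:: 2; 3; 7; 7; 2]; [:: 2; 5; 6; 5; 3]; [:: 3; 2; 7; 3; 6];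
   [:: 3; 4; 2; 7; 5]; [:: 3; 4; 6; 1; 7]; [:: 3; 5; 6; 7; 0]; [:: 3; 7; 5; 5; 1];
   [:: 11; 3; 1; 3; 3]]%N.

Definition functional1 : seq (seq nat) :=
  [::
   [:: 1; 3; 1; 2; 14]; [:: 3; 2; 1; 0; 15]; [:: 5; 3; 1; 10; 2]; [:: 7; 1; 1; 2; 10];
   [:: 7; 2; 1; 8; 3]; [:: 7; 3; 0; 0; 11]]%N.

Definition functional2 : seq (seq nat) :=
  [::
   [:: 3; 3; 5; 0; 10]; [:: 5; 2; 3; 1; 10]; [:: 5; 7; 3; 0; 6]; [:: 7; 1; 1; 2; 10];
   [:: 7; 3; 0; 0; 11]; [:: 7; 6; 1; 1; 6]; [:: 7; 11; 1; 0; 2]]%N.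

Definition functional3 : seq (seq nat) :=
  [::
   [:: 2; 3; 3; 1; 12]; [:: 4; 3; 3; 5; 6]; [:: 4; 3; 5; 2; 7]; [:: 5; 2; 3; 1; 10];
   [:: 6; 3; 3; 9; 0]; [:: 6; 3; 5; 6; 1]; [:: 7; 2; 3; 5; 4]; [:: 7; 2; 5; 2; 5]]%N.

Definition functional4 : seq (seq nat) :=
  [::
   [:: 1; 5; 7; 5; 3]; [:: 1; 7; 2; 9; 2]; [:: 3; 4; 3; 9; 2]; [:: 3; 5; 2; 1; 10];
   [:: 3; 6; 2; 7; 3]; [:: 5; 2; 3; 1; 10]; [:: 9; 3; 2; 1; 6]; [:: 11; 0; 3; 1; 6];
   [:: 15; 1; 2; 1; 2]]%N.

(** Each entry c contributes the rotation orbit of Sq^(21-|c|) y^c. Their total equals the circulant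
    image of the invariant class plus the class itself, as polynomials. *)
Definition circ_cert : seq (seq nat) :=
  [::
   [:: 9; 3; 0; 0; 1]; [:: 12; 0; 0; 0; 7]; [:: 7; 7; 0; 3; 3]; [:: 8; 0; 3; 5; 4];
   [:: 8; 2; 2; 1; 6]; [:: 9; 4; 1; 3; 3]; [:: 6; 3; 4; 2; 5]; [:: 8; 0; 1; 6; 4];
   [:: 10; 0; 5; 0; 2]; [:: 8; 7; 0; 5; 0]; [:: 8; 4; 1; 1; 6]; [:: 8; 1; 1; 0; 3];
   [:: 12; 1; 4; 2; 1]; [:: 12; 5; 0; 1; 2]; [:: 8; 5; 5; 1; 1]; [:: 7; 3; 2; 7; 1];
   [:: 8; 3; 8; 0; 1]; [:: 14; 0; 2; 3; 1]; [:: 7; 1; 5; 4; 2]; [:: 9; 0; 3; 7; 1];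
   [:: 8; 5; 3; 2; 1]; [:: 7; 5; 3; 0; 4]; [:: 7; 7; 0; 1; 4]; [:: 13; 3; 3; 0; 0];
   [:: 11; 1; 2; 3; 3]; [:: 15; 2; 1; 1; 0]; [:: 9; 2; 2; 3; 3]; [:: 7; 1; 1; 6; 2];
   [:: 7; 1; 7; 1; 3]; [:: 6; 6; 1; 3; 1]; [:: 7; 5; 1; 3; 3]; [:: 5; 3; 11; 1; 0];
   [:: 0; 10; 0; 3; 7]; [:: 1; 8; 3; 2; 5]; [:: 3; 10; 6; 0; 1]; [:: 5; 8; 0; 1; 6];
   [:: 9; 3; 2; 5; 0]; [:: 3; 2; 1; 6; 8]; [:: 4; 0; 4; 5; 6]; [:: 2; 4; 7; 7; 0];
   [:: 0; 3; 10; 6; 0]; [:: 2; 5; 4; 0; 8]; [:: 0; 1; 0; 9; 9]; [:: 0; 4; 3; 9; 4];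
   [:: 4; 1; 8; 1; 3]; [:: 2; 7; 4; 0; 0]; [:: 2; 1; 0; 15; 2]; [:: 4; 1; 6; 8; 0];
   [:: 2; 9; 1; 1; 0]; [:: 8; 5; 1; 1; 4]; [:: 10; 1; 0; 0; 9]; [:: 14; 5; 0; 1; 0];
   [:: 0; 0; 7; 8; 4]; [:: 5; 9; 0; 1; 2]; [:: 1; 2; 4; 11; 1]; [:: 10; 3; 4; 0; 0];
   [:: 5; 3; 0; 2; 10]; [:: 3; 14; 0; 2; 1]; [:: 1; 6; 0; 6; 4]; [:: 4; 0; 8; 1; 7];
   [:: 4; 3; 1; 8; 1]; [:: 2; 6; 6; 5; 1]; [:: 0; 1; 1; 11; 0]; [:: 13; 1; 0; 6; 0];
   [:: 0; 1; 17; 1; 1]; [:: 0; 5; 13; 0; 2]; [:: 2; 1; 2; 12; 3]; [:: 0; 1; 15; 2; 1];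
   [:: 4; 4; 0; 4; 7]; [:: 10; 0; 1; 2; 4]; [:: 11; 1; 0; 2; 6]; [:: 2; 3; 1; 10; 4];
   [:: 1; 2; 4; 13; 0]; [:: 10; 0; 5; 0; 4]; [:: 9; 1; 5; 0; 2]; [:: 0; 0; 13; 1; 6];
   [:: 0; 2; 2; 12; 3]; [:: 0; 2; 4; 11; 3]; [:: 7; 1; 3; 5; 4]; [:: 4; 1; 1; 2; 12];
   [:: 0; 7; 8; 4; 1]; [:: 3; 8; 7; 0; 1]; [:: 6; 2; 9; 0; 3]; [:: 5; 0; 8; 3; 4];
   [:: 9; 7; 0; 3; 1]; [:: 8; 3; 0; 8; 1]; [:: 10; 2; 0; 4; 3]; [:: 6; 0; 1; 0; 13];
   [:: 2; 8; 1; 9; 0]; [:: 4; 4; 0; 0; 9]; [:: 5; 2; 1; 8; 3]; [:: 1; 7; 10; 1; 0];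
   [:: 1; 0; 11; 6; 2]; [:: 9; 1; 5; 4; 0]; [:: 11; 0; 7; 1; 1]; [:: 2; 8; 5; 3; 2];
   [:: 7; 1; 1; 8; 3]; [:: 0; 0; 1; 13; 3]; [:: 6; 6; 3; 0; 4]; [:: 4; 3; 9; 2; 2];
   [:: 3; 1; 4; 11; 1]; [:: 6; 8; 0; 3; 3]; [:: 1; 0; 5; 9; 2]; [:: 5; 5; 0; 0; 3];
   [:: 5; 0; 6; 6; 3]; [:: 5; 2; 7; 1; 5]; [:: 2; 2; 10; 0; 3]; [:: 10; 4; 1; 1; 4];
   [:: 1; 1; 0; 11; 6]; [:: 1; 2; 6; 4; 4]; [:: 0; 2; 2; 0; 9]; [:: 0; 8; 1; 3; 7];
   [:: 2; 2; 1; 4; 11]; [:: 0; 0; 3; 2; 8]; [:: 5; 1; 2; 4; 1]; [:: 2; 2; 3; 1; 12];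
   [:: 0; 2; 0; 11; 4]; [:: 9; 7; 2; 0; 2]; [:: 6; 6; 3; 2; 3]; [:: 9; 3; 6; 1; 1];
   [:: 6; 9; 2; 0; 0]; [:: 7; 8; 2; 0; 2]; [:: 3; 0; 2; 6; 8]; [:: 4; 11; 1; 0; 4];
   [:: 2; 1; 6; 6; 5]; [:: 1; 2; 1; 0; 15]; [:: 12; 1; 2; 1; 4]; [:: 3; 4; 11; 1; 0];
   [:: 2; 7; 1; 1; 8]; [:: 1; 2; 0; 13; 1]; [:: 4; 3; 5; 6; 1]; [:: 13; 1; 2; 1; 2];
   [:: 0; 13; 1; 4; 2]; [:: 9; 1; 7; 3; 0]; [:: 1; 5; 2; 3; 9]; [:: 1; 1; 6; 2; 9];
   [:: 1; 13; 5; 0; 1]; [:: 2; 8; 1; 7; 1]; [:: 7; 1; 5; 2; 5]; [:: 1; 3; 1; 6; 8];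
   [:: 2; 7; 1; 3; 7]; [:: 1; 3; 6; 2; 1]; [:: 9; 3; 4; 2; 1]; [:: 4; 5; 6; 1; 3];
   [:: 1; 1; 0; 7; 8]; [:: 3; 8; 3; 2; 1]; [:: 6; 4; 2; 5; 2]; [:: 1; 15; 2; 1; 1];
   [:: 1; 5; 1; 6; 0]; [:: 1; 4; 7; 5; 3]; [:: 4; 1; 12; 1; 2]; [:: 1; 1; 0; 13; 5];
   [:: 5; 2; 3; 5; 4]; [:: 0; 5; 9; 0; 3]; [:: 7; 4; 6; 1; 1]; [:: 4; 3; 3; 9; 0];
   [:: 5; 7; 7; 0; 1]; [:: 9; 0; 3; 1; 6]; [:: 3; 2; 1; 4; 9]; [:: 4; 3; 9; 0; 3];
   [:: 2; 0; 13; 3; 1]; [:: 0; 9; 5; 5; 1]; [:: 3; 7; 1; 3; 5]; [:: 7; 2; 9; 0; 1];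
   [:: 5; 3; 9; 2; 0]; [:: 5; 7; 5; 3; 0]; [:: 1; 0; 9; 3; 4]; [:: 4; 7; 1; 7; 1];
   [:: 0; 4; 3; 3; 7]; [:: 1; 1; 2; 8; 7]; [:: 3; 0; 0; 9; 7]; [:: 0; 5; 7; 7; 0];
   [:: 1; 8; 5; 1; 5]; [:: 1; 9; 7; 2; 0]; [:: 0; 3; 4; 3; 3]; [:: 9; 0; 1; 0; 7];
   [:: 1; 3; 1; 2; 10]; [:: 5; 11; 1; 2; 1]; [:: 0; 3; 3; 3; 11]; [:: 3; 3; 9; 0; 5];
   [:: 0; 3; 12; 3; 1]; [:: 0; 7; 6; 1; 3]; [:: 3; 7; 3; 0; 6]; [:: 1; 1; 4; 7; 7];
   [:: 8; 5; 1; 3; 3]; [:: 1; 7; 1; 1; 10]; [:: 2; 5; 2; 3; 7]; [:: 14; 3; 1; 1; 0];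
   [:: 1; 3; 3; 3; 9]; [:: 7; 2; 3; 5; 0]; [:: 2; 1; 4; 3; 7]; [:: 0; 3; 8; 3; 6];
   [:: 14; 1; 0; 0; 5]; [:: 4; 10; 0; 3; 3]; [:: 2; 9; 1; 1; 4]; [:: 0; 1; 5; 9; 4];
   [:: 11; 0; 1; 2; 6]; [:: 3; 11; 2; 4; 0]; [:: 4; 4; 5; 6; 1]; [:: 5; 10; 2; 2; 1];
   [:: 10; 0; 1; 0; 9]; [:: 3; 2; 8; 3; 4]; [:: 0; 4; 12; 1; 2]; [:: 2; 4; 5; 2; 7];
   [:: 8; 2; 3; 5; 2]; [:: 0; 0; 3; 6; 10]; [:: 6; 1; 4; 9; 0]; [:: 0; 1; 3; 14; 2];
   [:: 3; 6; 0; 8; 3]; [:: 6; 12; 1; 0; 0]; [:: 5; 6; 4; 4; 0]; [:: 1; 0; 3; 4; 9];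
   [:: 12; 3; 4; 0; 0]; [:: 9; 1; 1; 2; 6]; [:: 2; 1; 2; 4; 11]; [:: 1; 2; 2; 8; 7];
   [:: 2; 1; 0; 1; 13]; [:: 0; 12; 0; 1; 4]; [:: 2; 1; 0; 7; 10]; [:: 1; 7; 2; 5; 4];
   [:: 1; 3; 2; 12; 1]; [:: 5; 8; 1; 5; 0]; [:: 7; 2; 5; 0; 6]; [:: 2; 11; 0; 3; 3];
   [:: 4; 0; 11; 2; 2]; [:: 7; 3; 9; 0; 1]; [:: 1; 7; 0; 8; 3]; [:: 4; 1; 0; 11; 4];
   [:: 3; 2; 6; 0; 6]; [:: 6; 1; 2; 10; 0]; [:: 1; 7; 0; 4; 5]; [:: 7; 5; 4; 4; 0];
   [:: 2; 3; 6; 8; 0]; [:: 0; 1; 3; 0; 9]; [:: 2; 4; 1; 8; 5]; [:: 3; 7; 8; 2; 0];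
   [:: 1; 10; 7; 2; 0]; [:: 2; 5; 5; 8; 0]; [:: 0; 1; 7; 6; 5]; [:: 10; 1; 5; 0; 4];
   [:: 4; 4; 9; 0; 3]; [:: 6; 3; 1; 10; 0]; [:: 3; 4; 1; 4; 5]; [:: 0; 10; 5; 3; 2];
   [:: 13; 2; 2; 1; 2]; [:: 7; 7; 1; 5; 0]; [:: 5; 10; 0; 3; 1]; [:: 0; 0; 7; 0; 12];
   [:: 0; 1; 7; 8; 4]; [:: 5; 0; 1; 7; 0]; [:: 4; 0; 3; 2; 4]; [:: 3; 4; 7; 1; 5];
   [:: 4; 0; 5; 7; 1]; [:: 3; 0; 0; 1; 15]; [:: 9; 6; 1; 3; 1]; [:: 4; 3; 3; 3; 7];
   [:: 5; 3; 1; 6; 4]; [:: 2; 3; 10; 4; 1]; [:: 5; 0; 0; 1; 11]; [:: 2; 6; 2; 1; 8];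
   [:: 2; 1; 7; 6; 1]; [:: 1; 0; 10; 1; 1]; [:: 3; 0; 9; 5; 3]; [:: 1; 6; 0; 4; 9];
   [:: 12; 2; 0; 0; 5]; [:: 7; 9; 2; 0; 2]; [:: 0; 0; 1; 11; 8]; [:: 1; 4; 5; 0; 10];
   [:: 5; 1; 0; 11; 2]; [:: 1; 6; 0; 2; 10]; [:: 1; 3; 10; 0; 5]; [:: 4; 6; 4; 2; 3];
   [:: 9; 6; 3; 0; 2]; [:: 0; 2; 15; 0; 2]; [:: 8; 2; 3; 3; 3]; [:: 13; 0; 5; 0; 2];
   [:: 5; 2; 12; 1; 0]; [:: 1; 6; 7; 3; 0]; [:: 3; 5; 9; 2; 0]; [:: 7; 9; 0; 3; 1];
   [:: 5; 1; 6; 4; 4]; [:: 4; 0; 9; 1; 3]; [:: 0; 3; 6; 6; 5]; [:: 0; 1; 9; 5; 5];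
   [:: 4; 3; 1; 6; 6]; [:: 1; 5; 7; 3; 4]; [:: 1; 1; 5; 11; 1]; [:: 0; 0; 1; 5; 11];
   [:: 7; 3; 5; 4; 0]; [:: 6; 3; 3; 7; 1]; [:: 3; 1; 6; 0; 10]; [:: 0; 6; 7; 5; 1];
   [:: 2; 5; 7; 3; 2]; [:: 1; 0; 1; 13; 5]; [:: 6; 5; 2; 5; 2]; [:: 2; 0; 5; 7; 5];
   [:: 1; 14; 3; 1; 1]; [:: 1; 5; 9; 0; 5]; [:: 1; 4; 3; 3; 9]; [:: 1; 6; 2; 1; 10];
   [:: 2; 5; 3; 9; 0]; [:: 1; 0; 5; 7; 7]; [:: 5; 8; 3; 2; 1]; [:: 0; 1; 3; 12; 3];
   [:: 0; 6; 7; 1; 3]; [:: 10; 1; 3; 1; 4]; [:: 0; 10; 1; 7; 1]; [:: 2; 5; 7; 5; 1];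
   [:: 2; 1; 11; 4; 1]; [:: 1; 7; 4; 2; 5]; [:: 3; 1; 15; 0; 0]; [:: 3; 11; 0; 1; 2];
   [:: 3; 4; 1; 8; 3]; [:: 0; 10; 3; 6; 1]; [:: 1; 1; 11; 4; 3]; [:: 1; 5; 3; 7; 3];
   [:: 3; 8; 1; 1; 6]; [:: 6; 3; 3; 5; 2]; [:: 1; 10; 1; 5; 0]; [:: 2; 3; 8; 5; 1];
   [:: 11; 1; 3; 5; 0]; [:: 5; 3; 1; 8; 3]; [:: 3; 9; 3; 0; 2]; [:: 1; 1; 13; 1; 4];
   [:: 3; 0; 1; 15; 0]; [:: 1; 5; 7; 1; 5]; [:: 3; 7; 8; 0; 1]; [:: 1; 1; 7; 10; 1];
   [:: 7; 1; 6; 2; 1]; [:: 5; 7; 1; 1; 6]; [:: 6; 3; 1; 8; 1]; [:: 5; 8; 5; 1; 1];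
   [:: 3; 8; 1; 3; 5]; [:: 1; 7; 2; 7; 3]; [:: 1; 6; 11; 1; 0]; [:: 0; 9; 1; 3; 7];
   [:: 5; 1; 8; 1; 5]; [:: 0; 0; 5; 3; 11]; [:: 5; 1; 4; 7; 3]; [:: 7; 2; 1; 4; 5];
   [:: 3; 5; 0; 0; 11]; [:: 3; 1; 4; 3; 9]; [:: 5; 1; 4; 1; 6]; [:: 1; 9; 3; 2; 5];
   [:: 3; 0; 1; 3; 6]; [:: 0; 1; 5; 11; 3]; [:: 1; 5; 3; 9; 2]; [:: 2; 7; 2; 7; 1];
   [:: 7; 0; 0; 9; 3]; [:: 2; 5; 1; 0; 5]; [:: 5; 3; 3; 3; 5]; [:: 1; 5; 1; 12; 1];
   [:: 7; 1; 1; 0; 11]; [:: 5; 1; 0; 13; 1]; [:: 3; 9; 7; 0; 1]; [:: 1; 5; 5; 6; 3];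
   [:: 3; 13; 1; 2; 1]; [:: 13; 0; 3; 1; 2]; [:: 7; 7; 3; 0; 2]; [:: 3; 4; 3; 1; 6];
   [:: 4; 4; 3; 3; 3]; [:: 6; 5; 2; 3; 3]; [:: 2; 4; 3; 3; 7]; [:: 1; 3; 6; 2; 5];
   [:: 2; 5; 5; 2; 3]; [:: 0; 0; 1; 3; 16]; [:: 5; 3; 10; 0; 1]; [:: 0; 9; 4; 4; 2];
   [:: 3; 0; 1; 7; 8]; [:: 4; 7; 0; 6; 2]; [:: 13; 3; 0; 0; 3]; [:: 2; 2; 9; 5; 1];
   [:: 0; 3; 2; 2; 12]; [:: 1; 11; 5; 3; 0]; [:: 0; 1; 12; 2; 2]; [:: 0; 8; 2; 1; 8];
   [:: 4; 2; 0; 9; 5]; [:: 6; 1; 2; 4; 7]; [:: 10; 0; 0; 9; 1]; [:: 0; 3; 11; 6; 0];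
   [:: 2; 3; 2; 8; 5]; [:: 0; 2; 0; 1; 17]; [:: 10; 5; 4; 0; 0]; [:: 9; 2; 1; 2; 6];
   [:: 9; 1; 6; 4; 0]; [:: 12; 3; 0; 0; 5]; [:: 0; 5; 6; 4; 2]; [:: 3; 2; 4; 1; 10];
   [:: 6; 2; 4; 7; 1]; [:: 1; 8; 4; 2; 5]; [:: 5; 7; 4; 4; 0]; [:: 9; 0; 0; 1; 7];
   [:: 2; 0; 0; 10; 1]; [:: 4; 0; 3; 8; 5]; [:: 5; 2; 0; 5; 5]; [:: 5; 2; 6; 0; 6];
   [:: 1; 0; 6; 13; 0]; [:: 4; 3; 6; 0; 4]; [:: 2; 0; 8; 6; 1]; [:: 1; 1; 8; 2; 1];
   [:: 1; 2; 0; 3; 14]; [:: 7; 2; 10; 0; 1]; [:: 3; 4; 6; 4; 0]; [:: 4; 5; 5; 4; 2];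
   [:: 10; 0; 0; 7; 2]; [:: 3; 7; 0; 0; 7]; [:: 2; 4; 4; 5; 2]; [:: 1; 3; 4; 3; 9];
   [:: 0; 1; 2; 9; 1]; [:: 5; 3; 8; 3; 0]; [:: 10; 0; 4; 3; 3]; [:: 6; 0; 7; 6; 1];
   [:: 1; 15; 1; 2; 1]; [:: 6; 1; 0; 7; 6]; [:: 4; 5; 1; 10; 0]; [:: 6; 6; 2; 3; 3];
   [:: 5; 4; 3; 1; 6]; [:: 0; 5; 12; 1; 2]; [:: 3; 7; 0; 6; 4]; [:: 3; 3; 4; 7; 3];
   [:: 2; 0; 1; 7; 10]; [:: 1; 2; 7; 8; 2]; [:: 9; 5; 0; 0; 3]; [:: 1; 0; 8; 10; 1];
   [:: 4; 4; 1; 4; 7]; [:: 12; 1; 1; 2; 4]; [:: 1; 1; 5; 5; 8]; [:: 4; 1; 9; 5; 1];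
   [:: 0; 2; 7; 6; 5]; [:: 7; 8; 1; 1; 2]; [:: 2; 2; 0; 3; 12]; [:: 7; 3; 1; 4; 5];
   [:: 10; 3; 3; 1; 0]; [:: 6; 1; 4; 1; 8]; [:: 2; 4; 0; 3; 4]; [:: 11; 0; 4; 5; 0];
   [:: 4; 3; 10; 0; 3]; [:: 7; 0; 9; 3; 0]; [:: 1; 0; 14; 1; 4]; [:: 0; 5; 4; 7; 1];
   [:: 3; 2; 15; 0; 0]; [:: 1; 0; 2; 5; 5]; [:: 2; 0; 10; 7; 0]; [:: 0; 3; 11; 4; 1];
   [:: 5; 9; 3; 0; 2]; [:: 2; 0; 5; 1; 12]; [:: 7; 6; 2; 5; 0]; [:: 4; 1; 7; 6; 1];
   [:: 3; 4; 0; 5; 1]; [:: 0; 5; 10; 4; 1]; [:: 3; 3; 4; 5; 4]; [:: 2; 0; 1; 1; 13];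
   [:: 1; 2; 1; 15; 0]; [:: 7; 2; 0; 1; 3]; [:: 5; 11; 2; 0; 2]; [:: 1; 2; 9; 5; 3];
   [:: 1; 0; 10; 7; 2]; [:: 6; 1; 0; 5; 7]; [:: 0; 7; 7; 3; 2]; [:: 1; 7; 9; 2; 0];
   [:: 3; 1; 7; 4; 4]; [:: 4; 3; 2; 6; 2]; [:: 3; 3; 0; 13; 1]; [:: 0; 8; 2; 3; 7];
   [:: 7; 2; 8; 1; 1]; [:: 1; 11; 3; 4; 0]; [:: 1; 2; 5; 11; 1]; [:: 0; 11; 1; 7; 1];
   [:: 2; 6; 3; 7; 1]; [:: 3; 7; 0; 4; 5]; [:: 1; 0; 10; 5; 3]; [:: 10; 7; 1; 1; 0];
   [:: 10; 7; 3; 0; 0]; [:: 0; 11; 3; 2; 3]; [:: 2; 1; 9; 1; 7]; [:: 1; 8; 2; 3; 5];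
   [:: 4; 1; 1; 11; 0]; [:: 1; 2; 5; 9; 2]; [:: 0; 13; 0; 3; 3]; [:: 1; 10; 1; 1; 6];
   [:: 1; 10; 1; 3; 5]; [:: 4; 1; 9; 3; 2]; [:: 5; 3; 1; 0; 11]; [:: 2; 6; 7; 1; 3];
   [:: 3; 6; 1; 0; 3]; [:: 1; 5; 1; 4; 9]; [:: 1; 3; 0; 3; 10]; [:: 1; 3; 2; 4; 9];
   [:: 1; 1; 3; 6; 8]; [:: 11; 1; 1; 0; 7]; [:: 9; 1; 8; 1; 1]; [:: 1; 1; 3; 8; 7];
   [:: 2; 5; 3; 1; 8]; [:: 1; 1; 14; 1; 0]; [:: 3; 3; 6; 2; 5]; [:: 5; 5; 7; 1; 1];
   [:: 1; 1; 3; 2; 10]; [:: 0; 9; 2; 7; 1]; [:: 2; 1; 3; 4; 7]; [:: 13; 1; 1; 4; 1];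
   [:: 1; 9; 6; 3; 0]; [:: 7; 1; 4; 3; 5]; [:: 0; 3; 7; 6; 1]; [:: 3; 1; 9; 3; 4];
   [:: 7; 0; 5; 5; 0]; [:: 4; 0; 1; 5; 7]; [:: 1; 0; 1; 5; 13]; [:: 0; 2; 9; 1; 7];
   [:: 0; 1; 5; 3; 11]; [:: 0; 1; 14; 3; 1]; [:: 1; 0; 3; 0; 15]; [:: 5; 3; 2; 0; 3];
   [:: 3; 0; 1; 9; 7]; [:: 3; 2; 13; 1; 0]; [:: 1; 5; 3; 1; 10]; [:: 3; 6; 9; 0; 1];
   [:: 5; 11; 0; 1; 2]; [:: 7; 6; 2; 3; 1]; [:: 1; 7; 11; 1; 0]; [:: 1; 6; 1; 8; 3];
   [:: 9; 5; 2; 3; 1]; [:: 3; 1; 7; 6; 3]; [:: 5; 2; 4; 3; 5]; [:: 9; 7; 1; 1; 2];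
   [:: 3; 1; 3; 6; 4]; [:: 2; 1; 7; 2; 7]; [:: 3; 1; 3; 10; 2]; [:: 0; 2; 5; 3; 7];
   [:: 2; 3; 4; 3; 7]; [:: 3; 1; 1; 13; 1]; [:: 2; 1; 1; 3; 12]; [:: 3; 5; 10; 0; 1];
   [:: 3; 0; 8; 0; 6]; [:: 8; 1; 1; 3; 0]; [:: 2; 4; 2; 4; 7]; [:: 0; 8; 5; 0; 4];
   [:: 3; 0; 8; 4; 4]; [:: 6; 0; 1; 1; 9]; [:: 0; 4; 11; 4; 1]; [:: 0; 2; 0; 10; 1];
   [:: 6; 12; 0; 1; 0]; [:: 12; 1; 2; 2; 0]; [:: 3; 1; 3; 4; 9]; [:: 14; 0; 4; 1; 0];
   [:: 2; 1; 0; 8; 2]; [:: 0; 6; 0; 11; 0]; [:: 2; 14; 0; 1; 0]; [:: 0; 6; 1; 0; 13];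
   [:: 1; 9; 4; 0; 6]; [:: 3; 11; 1; 5; 0]; [:: 4; 7; 1; 0; 1]; [:: 12; 0; 2; 0; 5];
   [:: 9; 0; 5; 1; 2]; [:: 2; 1; 3; 0; 13]; [:: 2; 9; 0; 2; 4]; [:: 1; 2; 8; 0; 2];
   [:: 0; 2; 12; 0; 3]; [:: 8; 4; 1; 2; 4]; [:: 7; 1; 11; 0; 1]; [:: 3; 0; 6; 9; 2];
   [:: 11; 0; 0; 3; 6]; [:: 1; 1; 12; 2; 4]; [:: 2; 7; 3; 5; 2]; [:: 6; 5; 5; 0; 4];
   [:: 2; 9; 2; 5; 2]; [:: 10; 0; 1; 1; 1]; [:: 1; 8; 1; 0; 3]; [:: 4; 2; 7; 6; 1];
   [:: 8; 1; 3; 0; 1]; [:: 9; 2; 6; 0; 2]; [:: 0; 5; 2; 2; 8]; [:: 0; 4; 2; 0; 13];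
   [:: 2; 1; 12; 2; 2]; [:: 4; 6; 1; 2; 4]; [:: 1; 4; 15; 0; 0]; [:: 1; 14; 0; 5; 0];
   [:: 7; 3; 6; 4; 0]; [:: 18; 0; 1; 0; 1]; [:: 12; 3; 5; 0; 0]; [:: 0; 9; 3; 1; 0];
   [:: 3; 0; 10; 3; 4]; [:: 2; 5; 8; 3; 2]; [:: 3; 3; 0; 3; 10]; [:: 13; 0; 4; 1; 2];
   [:: 2; 6; 1; 2; 8]; [:: 7; 5; 5; 2; 1]; [:: 8; 11; 0; 1; 0]; [:: 2; 4; 2; 0; 9];
   [:: 2; 7; 5; 4; 2]; [:: 1; 10; 6; 3; 0]; [:: 0; 7; 5; 0; 8]; [:: 4; 6; 1; 6; 2];
   [:: 3; 2; 1; 11; 2]; [:: 9; 1; 2; 0; 7]; [:: 4; 7; 0; 0; 9]; [:: 3; 13; 2; 0; 2];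
   [:: 2; 0; 6; 5; 6]; [:: 6; 3; 2; 8; 1]; [:: 5; 2; 11; 2; 0]; [:: 1; 0; 9; 2; 1];
   [:: 0; 3; 7; 4; 6]; [:: 2; 11; 1; 1; 4]; [:: 2; 3; 0; 3; 12]; [:: 1; 9; 0; 0; 7];
   [:: 5; 0; 14; 1; 0]; [:: 7; 2; 2; 2; 6]; [:: 1; 2; 3; 0; 11]; [:: 5; 0; 1; 3; 10];
   [:: 3; 9; 4; 2; 1]; [:: 8; 2; 2; 4; 3]; [:: 0; 2; 10; 7; 0]; [:: 1; 4; 4; 1; 10];
   [:: 2; 7; 1; 8; 1]; [:: 3; 4; 4; 5; 4]; [:: 0; 1; 2; 1; 9]; [:: 2; 4; 0; 7; 6];
   [:: 0; 1; 2; 15; 2]; [:: 7; 2; 0; 5; 5]; [:: 1; 14; 2; 0; 2]; [:: 6; 1; 5; 1; 4];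
   [:: 2; 5; 8; 1; 3]; [:: 9; 4; 3; 3; 1]; [:: 3; 4; 0; 11; 2]; [:: 5; 3; 4; 1; 6];
   [:: 0; 1; 2; 13; 3]; [:: 3; 2; 5; 5; 4]; [:: 1; 0; 15; 1; 0]; [:: 5; 7; 0; 0; 7];
   [:: 2; 7; 3; 7; 1]; [:: 12; 3; 3; 1; 0]; [:: 1; 12; 3; 2; 1]; [:: 3; 7; 7; 3; 0];
   [:: 4; 1; 3; 4; 7]; [:: 7; 2; 0; 7; 4]; [:: 6; 5; 1; 0; 5]; [:: 1; 1; 2; 15; 0];
   [:: 5; 0; 10; 1; 1]; [:: 11; 1; 0; 7; 0]; [:: 6; 5; 3; 1; 4]; [:: 3; 7; 5; 4; 0];
   [:: 3; 7; 5; 0; 2]; [:: 0; 5; 0; 5; 7]; [:: 3; 2; 9; 1; 5]; [:: 5; 1; 3; 8; 3];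
   [:: 3; 7; 1; 6; 0]; [:: 10; 1; 0; 7; 2]; [:: 1; 1; 2; 11; 2]; [:: 3; 1; 1; 7; 8];
   [:: 1; 7; 5; 0; 6]; [:: 1; 2; 5; 3; 9]; [:: 5; 2; 0; 1; 11]; [:: 7; 0; 5; 3; 5];
   [:: 0; 7; 1; 4; 7]; [:: 7; 3; 6; 2; 1]; [:: 5; 6; 1; 4; 1]; [:: 3; 5; 8; 3; 0];
   [:: 3; 2; 1; 13; 1]; [:: 11; 5; 0; 0; 3]; [:: 5; 5; 3; 1; 6]; [:: 3; 5; 2; 0; 3];
   [:: 3; 6; 3; 1; 6]; [:: 3; 3; 13; 1; 0]; [:: 1; 5; 4; 1; 6]; [:: 1; 10; 6; 1; 1];
   [:: 1; 3; 11; 0; 5]; [:: 3; 9; 6; 1; 1]; [:: 2; 3; 9; 3; 2]; [:: 5; 10; 1; 1; 2];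
   [:: 3; 2; 3; 8; 3]; [:: 7; 5; 1; 6; 0]; [:: 11; 3; 1; 4; 1]; [:: 5; 6; 3; 5; 0];
   [:: 7; 3; 2; 4; 1]; [:: 1; 5; 0; 11; 2]; [:: 3; 2; 1; 7; 4]; [:: 6; 1; 3; 4; 3];
   [:: 1; 5; 4; 7; 3]; [:: 7; 9; 1; 1; 2]; [:: 2; 2; 5; 3; 7]; [:: 8; 0; 5; 3; 3];
   [:: 15; 1; 1; 0; 3]; [:: 2; 3; 0; 1; 13]; [:: 7; 1; 9; 3; 0]; [:: 1; 3; 3; 12; 1];
   [:: 1; 12; 5; 1; 1]; [:: 7; 5; 3; 5; 0]; [:: 7; 7; 2; 1; 2]; [:: 1; 3; 0; 1; 15];
   [:: 3; 7; 7; 1; 1]; [:: 1; 3; 3; 10; 2]; [:: 7; 3; 4; 1; 2]; [:: 2; 9; 2; 3; 3];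
   [:: 6; 1; 7; 2; 3]; [:: 3; 3; 2; 0; 11]; [:: 3; 13; 0; 1; 2]; [:: 7; 0; 1; 3; 6];
   [:: 9; 2; 4; 3; 1]; [:: 1; 3; 1; 13; 1]; [:: 11; 3; 1; 2; 2]; [:: 2; 5; 4; 3; 3];
   [:: 2; 1; 0; 4; 12]; [:: 4; 0; 9; 6; 1]; [:: 9; 2; 3; 4; 1]; [:: 0; 10; 1; 2; 4];
   [:: 2; 4; 1; 1; 9]; [:: 0; 7; 2; 4; 7]; [:: 0; 10; 5; 0; 4]; [:: 10; 8; 0; 0; 1];
   [:: 5; 2; 1; 1; 11]; [:: 1; 0; 8; 3; 1]; [:: 2; 3; 8; 0; 4]; [:: 5; 0; 13; 2; 0];
   [:: 0; 0; 14; 4; 1]; [:: 0; 0; 5; 2; 12]; [:: 5; 2; 0; 4; 2]; [:: 2; 1; 13; 2; 2];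
   [:: 4; 2; 10; 1; 3]; [:: 4; 3; 4; 2; 0]; [:: 7; 3; 7; 0; 2]; [:: 7; 5; 2; 6; 0];
   [:: 0; 17; 2; 0; 0]; [:: 0; 1; 7; 7; 5]; [:: 0; 6; 5; 7; 1]; [:: 1; 2; 0; 10; 7];
   [:: 5; 0; 0; 6; 9]; [:: 1; 3; 0; 16; 0]; [:: 0; 0; 1; 10; 9]; [:: 2; 0; 3; 11; 4];
   [:: 8; 1; 2; 1; 1]; [:: 2; 0; 3; 9; 5]; [:: 0; 2; 15; 1; 2]; [:: 2; 3; 10; 1; 3];
   [:: 5; 1; 2; 9; 3]; [:: 5; 0; 9; 2; 1]; [:: 7; 9; 0; 2; 2]; [:: 2; 6; 2; 0; 9];
   [:: 3; 2; 0; 14; 1]; [:: 6; 4; 0; 1; 9]; [:: 0; 13; 4; 0; 0]; [:: 3; 0; 3; 11; 2];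
   [:: 5; 0; 0; 4; 10]; [:: 5; 4; 5; 5; 0]; [:: 0; 6; 7; 6; 1]; [:: 3; 11; 0; 6; 0];
   [:: 9; 4; 0; 5; 1]; [:: 12; 2; 0; 1; 5]; [:: 1; 10; 5; 2; 1]; [:: 5; 6; 6; 2; 1];
   [:: 1; 1; 9; 4; 4]; [:: 4; 5; 0; 3; 8]; [:: 1; 0; 5; 4; 9]; [:: 4; 4; 3; 8; 1];
   [:: 6; 0; 2; 5; 7]; [:: 0; 8; 6; 2; 3]; [:: 6; 9; 0; 0; 5]; [:: 8; 2; 1; 7; 2];
   [:: 0; 2; 1; 8; 2]; [:: 4; 0; 7; 7; 1]; [:: 5; 8; 1; 6; 0]; [:: 3; 1; 4; 2; 10];
   [:: 4; 6; 0; 9; 1]; [:: 4; 1; 2; 7; 6]; [:: 3; 11; 4; 0; 2]; [:: 3; 1; 1; 8; 0];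
   [:: 4; 3; 3; 2; 8]; [:: 4; 6; 4; 3; 3]; [:: 3; 0; 9; 2; 5]; [:: 0; 12; 2; 3; 3];
   [:: 1; 5; 3; 8; 3]; [:: 0; 4; 1; 3; 12]; [:: 3; 2; 4; 6; 4]; [:: 3; 6; 4; 1; 6];
   [:: 2; 9; 1; 4; 3]; [:: 2; 1; 0; 0; 14]; [:: 0; 2; 2; 5; 11]; [:: 1; 7; 2; 6; 4];
   [:: 3; 1; 15; 1; 0]; [:: 0; 5; 1; 9; 5]; [:: 14; 0; 1; 1; 1]; [:: 2; 12; 2; 1; 0];
   [:: 1; 0; 1; 10; 7]; [:: 7; 0; 0; 4; 6]; [:: 0; 8; 4; 7; 1]; [:: 9; 0; 6; 5; 0];
   [:: 4; 2; 4; 4; 3]; [:: 0; 1; 3; 7; 6]; [:: 5; 0; 2; 3; 10]; [:: 1; 14; 1; 3; 1];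
   [:: 7; 5; 0; 7; 0]; [:: 5; 3; 5; 1; 6]; [:: 7; 0; 2; 7; 4]; [:: 5; 2; 10; 3; 0];
   [:: 3; 7; 8; 1; 1]; [:: 10; 2; 3; 2; 0]; [:: 9; 4; 0; 1; 3]; [:: 10; 3; 2; 0; 5];
   [:: 6; 4; 7; 0; 0]; [:: 12; 5; 1; 2; 0]; [:: 12; 0; 1; 3; 4]; [:: 2; 3; 6; 7; 1];
   [:: 1; 4; 3; 0; 11]; [:: 7; 2; 3; 2; 6]; [:: 2; 7; 4; 5; 2]; [:: 0; 7; 0; 7; 6];
   [:: 1; 3; 4; 8; 3]; [:: 5; 4; 7; 2; 1]; [:: 11; 0; 1; 1; 7]; [:: 4; 3; 1; 3; 8];
   [:: 1; 5; 3; 6; 4]; [:: 6; 2; 1; 1; 9]; [:: 1; 0; 3; 9; 7]; [:: 1; 3; 6; 5; 4];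
   [:: 3; 5; 9; 1; 1]; [:: 7; 1; 4; 4; 1]; [:: 2; 7; 0; 9; 1]; [:: 10; 1; 3; 0; 5];
   [:: 4; 1; 2; 5; 7]; [:: 1; 1; 2; 1; 15]; [:: 2; 5; 5; 5; 2]; [:: 6; 1; 2; 9; 1];
   [:: 2; 1; 9; 2; 3]; [:: 1; 4; 1; 3; 10]; [:: 3; 9; 1; 2; 2]; [:: 2; 3; 2; 1; 5];
   [:: 3; 1; 2; 5; 9]; [:: 2; 1; 11; 3; 2]; [:: 7; 1; 10; 1; 1]; [:: 0; 1; 7; 5; 6];
   [:: 5; 1; 2; 7; 4]; [:: 3; 5; 9; 3; 0]; [:: 6; 3; 3; 4; 3]; [:: 5; 0; 2; 1; 11];
   [:: 1; 7; 0; 9; 3]; [:: 15; 1; 0; 1; 3]; [:: 6; 5; 0; 1; 5]; [:: 7; 5; 2; 4; 1];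
   [:: 3; 9; 5; 2; 1]; [:: 11; 1; 3; 2; 2]; [:: 3; 5; 0; 1; 11]; [:: 1; 7; 4; 3; 5];
   [:: 3; 0; 11; 1; 5]; [:: 6; 3; 1; 9; 1]; [:: 5; 3; 1; 7; 4]; [:: 11; 1; 5; 1; 2];
   [:: 1; 9; 3; 1; 6]; [:: 3; 7; 6; 2; 1]; [:: 3; 0; 7; 1; 6]; [:: 3; 2; 6; 3; 5];
   [:: 6; 1; 2; 5; 3]; [:: 8; 7; 3; 1; 0]; [:: 7; 2; 3; 0; 7]; [:: 11; 3; 0; 3; 2];
   [:: 3; 11; 2; 1; 2]; [:: 0; 6; 5; 3; 3]; [:: 4; 0; 7; 3; 3]; [:: 1; 5; 1; 9; 3];
   [:: 5; 1; 2; 3; 6]; [:: 4; 11; 5; 0; 0]; [:: 2; 5; 6; 5; 2]; [:: 14; 0; 0; 2; 1];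
   [:: 2; 0; 0; 13; 4]; [:: 8; 5; 5; 1; 0]; [:: 2; 5; 0; 12; 0]; [:: 0; 3; 10; 0; 0];
   [:: 2; 7; 5; 3; 3]; [:: 0; 1; 2; 0; 10]; [:: 1; 4; 9; 2; 1]; [:: 3; 0; 4; 9; 3];
   [:: 2; 16; 1; 1; 0]; [:: 0; 0; 0; 5; 12]; [:: 2; 0; 11; 0; 0]; [:: 2; 7; 3; 6; 2];
   [:: 2; 4; 0; 6; 7]; [:: 10; 1; 4; 0; 5]; [:: 3; 0; 1; 0; 16]; [:: 5; 0; 6; 6; 0];
   [:: 0; 2; 8; 9; 0]; [:: 0; 9; 3; 0; 1]; [:: 2; 3; 3; 11; 0]; [:: 5; 0; 12; 1; 1];
   [:: 6; 1; 3; 9; 1]; [:: 0; 10; 0; 7; 2]; [:: 8; 3; 8; 0; 0]; [:: 0; 8; 7; 0; 4];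
   [:: 4; 4; 2; 7; 2]; [:: 4; 13; 0; 2; 0]; [:: 9; 1; 2; 1; 7]; [:: 0; 1; 0; 17; 2];
   [:: 5; 8; 2; 4; 1]; [:: 4; 2; 5; 6; 2]; [:: 0; 1; 8; 5; 6]; [:: 1; 8; 7; 4; 0];
   [:: 5; 4; 8; 2; 1]; [:: 3; 4; 2; 7; 4]; [:: 1; 2; 5; 0; 11]; [:: 9; 6; 0; 1; 3];
   [:: 11; 1; 4; 0; 3]; [:: 6; 0; 1; 0; 10]; [:: 6; 8; 4; 1; 0]; [:: 0; 15; 0; 2; 0];
   [:: 0; 5; 0; 10; 5]; [:: 5; 3; 0; 6; 5]; [:: 2; 1; 10; 4; 2]; [:: 5; 2; 7; 5; 0];
   [:: 5; 4; 6; 3; 1]; [:: 1; 0; 4; 1; 11]; [:: 0; 10; 0; 3; 4]; [:: 2; 4; 2; 3; 8];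
   [:: 9; 2; 4; 4; 1]; [:: 0; 0; 13; 7; 0]; [:: 3; 4; 4; 2; 6]; [:: 1; 0; 9; 1; 2];
   [:: 6; 2; 9; 0; 0]; [:: 5; 10; 1; 2; 2]; [:: 4; 2; 1; 0; 6]; [:: 4; 2; 9; 2; 3];
   [:: 1; 1; 8; 5; 4]; [:: 1; 14; 0; 2; 2]; [:: 1; 8; 1; 7; 0]; [:: 2; 9; 2; 2; 4];
   [:: 3; 9; 0; 3; 2]; [:: 4; 0; 8; 7; 1]; [:: 5; 0; 0; 7; 1]; [:: 7; 0; 1; 8; 4];
   [:: 0; 3; 7; 1; 8]; [:: 4; 10; 1; 0; 5]; [:: 5; 1; 7; 1; 6]; [:: 2; 4; 4; 0; 9];
   [:: 6; 7; 2; 0; 5]; [:: 6; 3; 6; 1; 4]; [:: 0; 7; 3; 0; 9]; [:: 2; 0; 4; 7; 6];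
   [:: 2; 7; 1; 7; 2]; [:: 7; 2; 2; 3; 6]; [:: 2; 1; 12; 3; 2]; [:: 0; 2; 12; 3; 2];
   [:: 0; 0; 13; 5; 1]; [:: 8; 1; 1; 2; 1]; [:: 3; 1; 14; 2; 0]; [:: 1; 6; 12; 0; 1];
   [:: 6; 7; 0; 3; 4]; [:: 1; 3; 1; 0; 8]; [:: 3; 0; 6; 6; 4]; [:: 0; 12; 1; 4; 3];
   [:: 3; 0; 6; 8; 3]; [:: 1; 0; 8; 1; 10]; [:: 0; 6; 4; 4; 3]; [:: 2; 9; 0; 7; 2];
   [:: 3; 11; 1; 4; 1]; [:: 0; 1; 6; 6; 6]; [:: 3; 0; 2; 0; 8]; [:: 3; 4; 6; 1; 6];
   [:: 7; 7; 2; 0; 3]; [:: 10; 1; 2; 1; 5]; [:: 2; 9; 0; 1; 5]; [:: 2; 2; 3; 7; 6];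
   [:: 4; 3; 2; 3; 8]; [:: 6; 7; 0; 1; 5]; [:: 1; 6; 6; 3; 1]; [:: 7; 7; 2; 2; 2];
   [:: 10; 2; 6; 1; 0]; [:: 7; 3; 8; 0; 2]; [:: 8; 7; 2; 2; 0]; [:: 1; 12; 3; 1; 2];
   [:: 3; 1; 6; 0; 3]; [:: 3; 0; 0; 15; 1]; [:: 12; 3; 3; 0; 1]; [:: 6; 0; 3; 3; 8];
   [:: 11; 1; 2; 5; 1]; [:: 7; 0; 1; 6; 5]; [:: 5; 3; 2; 3; 6]; [:: 1; 2; 12; 1; 1];
   [:: 2; 1; 1; 2; 13]; [:: 2; 3; 7; 7; 1]; [:: 2; 2; 1; 8; 6]; [:: 2; 7; 1; 9; 1];
   [:: 3; 4; 2; 5; 5]; [:: 1; 1; 8; 1; 6]; [:: 6; 1; 7; 1; 4]; [:: 6; 1; 5; 0; 5];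
   [:: 7; 0; 3; 3; 6]; [:: 0; 13; 3; 1; 0]; [:: 4; 1; 3; 5; 7]; [:: 1; 5; 2; 9; 3];
   [:: 5; 2; 9; 2; 1]; [:: 3; 7; 3; 6; 0]; [:: 1; 1; 2; 10; 3]; [:: 3; 7; 5; 3; 1];
   [:: 12; 1; 2; 1; 1]; [:: 1; 4; 2; 1; 11]; [:: 11; 5; 0; 1; 3]; [:: 2; 7; 3; 4; 3];
   [:: 0; 8; 5; 3; 3]; [:: 3; 2; 7; 3; 5]; [:: 5; 4; 2; 5; 1]; [:: 1; 1; 6; 4; 5];
   [:: 5; 0; 1; 2; 11]; [:: 5; 5; 1; 3; 6]; [:: 5; 1; 5; 4; 5]; [:: 0; 5; 2; 5; 7];
   [:: 3; 6; 3; 0; 7]; [:: 2; 1; 8; 3; 3]; [:: 5; 1; 3; 7; 4]; [:: 3; 2; 3; 3; 6];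
   [:: 4; 2; 3; 5; 3]; [:: 1; 5; 6; 1; 6]; [:: 1; 3; 1; 14; 1]; [:: 1; 3; 5; 8; 3];
   [:: 1; 3; 3; 11; 2]; [:: 6; 0; 3; 1; 9]; [:: 3; 1; 1; 6; 9]; [:: 4; 1; 1; 6; 7];
   [:: 7; 3; 6; 1; 2]; [:: 3; 11; 1; 2; 2]; [:: 7; 3; 0; 6; 1]; [:: 7; 3; 4; 0; 3];
   [:: 2; 5; 6; 3; 3]; [:: 1; 3; 7; 3; 5]; [:: 3; 2; 1; 6; 5]]%N.

(** * Evaluation of the certificates *)

Fixpoint lex_lt (s s' : seq nat) : bool :=
  match s, s' with
  | x :: r, x' :: r' => (x < x')%N || (x == x') && lex_lt r r'
  | _, _ => false
  end.

Definition rot_max (b : seq nat) : seq nat :=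
  foldr (fun i c => if lex_lt c (rot i b) then rot i b else c) b (iota 1 4).

Definition orbit_keys (s : seq (seq nat)) : seq (seq nat) :=
  keys (trie_of 5 (map rot_max s)).

(* Sq^k y^c is taken in degree 21, so k = 21 - |c|; [below21] ensures k > 0. *)
Definition hit_terms (cs : seq (seq nat)) : seq (seq nat) :=
  flatten [seq sq_terms (21 - sumn c) c | c <- cs].

Definition below21 (c : seq nat) := (size c == 5%N) && (sumn c < 21)%N.

Fixpoint reduces (known : seq (seq nat)) (steps : seq (seq nat * seq (seq nat))) :=
  if steps is (b, cs) :: steps' then
    let s := orbit_keys (hit_terms cs) in
    [&& all below21 cs, count_mem b s == 1%N, all (fun m => (m == b) || (m \in known)) s
      & reduces (b :: known) steps']
  else true.

Fixpoint compositions n d : seq (seq nat) :=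
  if n is n'.+1 then
    flatten [seq map (cons a) (compositions n' (d - a)%N) | a <- iota 0 d.+1]
  else if d is 0 then [:: [::]] else [::].

(** Horner form of [wt], convenient for evaluation. *)
Definition wt_of (b : seq nat) :=
  foldr (fun x s => (x + (s + s))%N) 0%N b.

(** Three binary digits suffice, as the exponents in [reps] are at most 7. *)
Definition bits_of (b : seq nat) : seq (nat * nat) :=
  flatten [seq [seq (i, j) | j <- iota 0 3 & odd (iter j half (nth 0%N b i))]
          | i <- iota 0 5].

Definition rots (b : seq nat) : seq (seq nat) := [seq rot i b | i <- iota 0 5].

(** The value of the functional [F] on the sum of the orbits of [s], computed on lists. *)
Definition parity (F s : seq (seq nat)) : bool :=
  odd (count (fun m => @lookup 5 m (trie_of 5 F)) (flatten (map rots s))).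

Definition circ_image (b : seq nat) := circ_terms (bits_of b).

Definition known_orbits := unzip1 reductions ++ reps.

Lemma reductionsP : reduces reps reductions.
Proof. by vm_compute. Qed.

Lemma known_orbitsP :
  all (fun b => (31 %| wt_of b)%N ==> (rot_max b \in known_orbits)) (compositions 5 21).
Proof. by vm_compute. Qed.

Definition detectors := [:: functional1; functional2; functional3; functional4].

(** Entry (i, j) is the value of the j-th detector on the i-th orbit plus its circulant image. Each
    column is a linear equation on the five coefficients. *)
Definition detection :=
  [:: [:: true; true; true; true];
      [:: false; false; false; true];
      [:: false; true; true; false];
      [:: false; false; false; true];
      [:: true; false; true; true]].

Lemma functional0_kills : kills functional0.
Proof. by vm_compute. Qed.

Lemma detectors_kill : all kills detectors.
Proof. by vm_compute. Qed.

Lemma functional0P :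
  parity functional0 [:: nth [::] reps 1; nth [::] reps 3].
Proof. by vm_compute. Qed.

Lemma bits_ofP : all (fun b => mon_of (bits_of b) == b) reps.
Proof. by vm_compute. Qed.

Lemma circ_imageP :
  [seq let s := u :: circ_image u in [seq parity F s | F <- detectors] | u <- reps]
  = detection.
Proof. by vm_compute. Qed.

Lemma circ_certP : all below21 circ_cert &&
  (orbit_keys (circ_image (nth [::] reps 1) ++ circ_image (nth [::] reps 3) ++
     [:: nth [::] reps 1; nth [::] reps 3] ++ hit_terms circ_cert) == [::]).
Proof. by vm_compute. Qed.

(** * Reduction to five orbits *)

Lemma rot_maxP b : exists i, rot_max b = rot i b.
Proof.
rewrite /rot_max; elim: (iota 1 4) => [|i s [j IH]] /=; first by exists 0%N; rewrite rot0.
by case: ifP => _; [exists i | exists j].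
Qed.

Lemma mem_compositions b : b \in compositions (size b) (sumn b).
Proof.
elim: b => // x b IHb; rewrite -[compositions _ _]/(flatten
  [seq map (cons a) (compositions (size b) (x + sumn b - a)%N)
  | a <- iota 0 (x + sumn b).+1]).
apply/flattenP; exists (map (cons x) (compositions (size b) (sumn b))).
  by apply/mapP; exists x; rewrite ?addKn // mem_iota ltnS leq_addr.
exact: map_f.
Qed.

Lemma wt_ofE b : size b = 5%N -> wt_of b = wt b.
Proof.
case: b => [|b0 [|b1 [|b2 [|b3 [|b4 []]]]]] // _.
by rewrite /wt !big_ord_recr big_ord0 /=; lia.
Qed.

Section Upper.
Variables (L : fieldExtType 'F_2) (t : L).
Hypothesis tE : t ^+ 5 + t ^+ 4 + t ^+ 2 + t + 1 = 0.
Local Notation ymon := (ymon t).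
Local Notation hitL := (@hitL L).

Definition orbsum (h : {mpoly L[5]}) : {mpoly L[5]} :=
  \sum_(i < 5) iter i (substL (mx_of cshift)) h.

Definition orb (b : seq nat) : {mpoly L[5]} := \sum_(i < 5) ymon (rot i b).

Lemma iter_linear (phi : {linear {mpoly L[5]} -> {mpoly L[5]}}) j : linear (iter j phi).
Proof. by elim: j => [|j IHj] c f g //=; rewrite IHj linearP. Qed.

Lemma orbsum_is_linear : linear orbsum.
Proof.
move=> c f g; rewrite /orbsum scaler_sumr -big_split; apply: eq_bigr => i _.
by rewrite (iter_linear (substL (mx_of cshift))).
Qed.

HB.instance Definition _ :=
  GRing.isLinear.Build L {mpoly L[5]} {mpoly L[5]} _ orbsum orbsum_is_linear.

Lemma orbsumZ c h : orbsum (c *: h) = c *: orbsum h.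
Proof. exact: linearZ. Qed.

Lemma iter_subst_SqL w j k (h : {mpoly L[5]}) :
  iter j (substL w) (SqL k h) = SqL k (iter j (substL w) h).
Proof. by elim: j => [//|j IHj]; rewrite !iterS IHj SqL_subst. Qed.

Lemma orbsum_SqL k h : orbsum (SqL k h) = SqL k (orbsum h).
Proof.
rewrite /orbsum linear_sum; apply: eq_bigr => i _.
exact: iter_subst_SqL.
Qed.

Lemma orbsum_ymon b : size b = 5%N -> orbsum (ymon b) = orb b.
Proof.
move=> b5; apply: eq_bigr => -[i i5] _ /=.
elim: i i5 => [|i IHi] i5 /=; first by rewrite rot0.
by rewrite IHi ?(ltnW i5) // cshift_ymon ?size_rot // -rotS ?b5 // ltnW.
Qed.

Lemma orb_rot i b : size b = 5%N -> orb (rot i b) = orb b.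
Proof.
move=> b5; have rot1 c : size c = 5%N -> orb (rot 1 c) = orb c.
  case: c => [|c0 [|c1 [|c2 [|c3 [|c4 []]]]]] // _.
  by rewrite /orb !big_ord_recr !big_ord0 /rot /=; ring.
have [i5|i5] := leqP i 5; last by rewrite rot_oversize // b5; exact: ltnW.
elim: i i5 => [|i IHi] i5; first by rewrite rot0.
by rewrite rotS ?b5 // rot1 ?size_rot // IHi // ltnW.
Qed.

Lemma orb_rot_max b : size b = 5%N -> orb (rot_max b) = orb b.
Proof. by move=> b5; have [i ->] := rot_maxP b; apply: orb_rot. Qed.

Lemma sum_orbit_keys s : all (fun m => size m == 5%N) s ->
  \sum_(m <- orbit_keys s) orb m = \sum_(m <- s) orb m.
Proof.
move=> s5; rewrite sum_keys; last 1 first.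
- by apply/allP => _ /mapP[m /(allP s5) /eqP m5 ->]; have [i ->] := rot_maxP m; rewrite size_rot m5.
- rewrite big_map; apply: eq_big_seq => m /(allP s5) /eqP m5.
  exact: orb_rot_max.
exact: AA2.
Qed.

Lemma size_hit_terms cs : all below21 cs -> all (fun m => size m == 5%N) (hit_terms cs).
Proof.
move=> cs21; apply/allP => m /flattenP[s /mapP[c /(allP cs21)/andP[/eqP c5 _] ->]].
exact: (allP (size_sq_terms _ c5)).
Qed.

(** The cyclic sum commutes with the squares, so the orbits of the terms of Sq^k y^c add up to Sq^k
    of the orbit of y^c. *)
Lemma hitL_hit_terms cs : all below21 cs -> hitL (\sum_(m <- hit_terms cs) orb m).
Proof.
move=> cs21; rewrite big_flatten big_map big_seq; apply: (big_ind hitL).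
- exact: hitL0.
- exact: hitL_add.
move=> c /(allP cs21)/andP[/eqP c5 c21].
rewrite (eq_big_seq (fun m => orbsum (ymon m))); last first.
  by move=> m /(allP (size_sq_terms _ c5)) /eqP m5; rewrite orbsum_ymon.
rewrite -linear_sum /= -SqL_ymon // orbsum_SqL.
by apply: hitL_Sq; rewrite subn_gt0.
Qed.

(* Signs do not matter: L has characteristic 2. *)
Definition spanned (h : {mpoly L[5]}) : Prop :=
  exists c : nat -> L, hitL (h + \sum_(i < 5) c i *: orb (nth [::] reps i)).

Lemma spanned_hit h : hitL h -> spanned h.
Proof.
by move=> Hh; exists (fun=> 0); rewrite big1 ?addr0 // => i _; rewrite scale0r.
Qed.

Lemma spanned_add f g : spanned f -> spanned g -> spanned (f + g).
Proof.
move=> [c Hc] [d Hd]; exists (fun i => c i + d i).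
under eq_bigr do rewrite scalerDl.
by rewrite big_split addrACA; apply: hitL_add.
Qed.

Lemma spanned_scale a f : spanned f -> spanned (a *: f).
Proof.
move=> [c Hc]; exists (fun i => a * c i).
under eq_bigr do rewrite -scalerA.
by rewrite -scaler_sumr -scalerDr; apply: hitL_scale.
Qed.

Lemma spanned_sum (I : eqType) (r : seq I) (F : I -> {mpoly L[5]}) :
  (forall i, i \in r -> spanned (F i)) -> spanned (\sum_(i <- r) F i).
Proof.
move=> HF; rewrite big_seq; apply: (big_ind spanned) => //.
  exact/spanned_hit/hitL0.
exact: spanned_add.
Qed.

Lemma spanned_reps b : b \in reps -> spanned (orb b).
Proof.
move=> b_in; have b5 : (index b reps < 5)%N by rewrite index_mem.
exists (fun j => (j == index b reps)%:R); rewrite (bigD1 (Ordinal b5)) //= big1.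
  rewrite eqxx scale1r nth_index // addr0 AA2; exact: hitL0.
by move=> j; rewrite -val_eqE /= => /negPf->; rewrite scale0r.
Qed.

(** Triangular elimination: the orbits in [s] add up to a hit polynomial, so modulo hits the orbit
    of [b] is the sum of the others, which are already spanned; [b] then joins the known ones. *)
Lemma spanned_reduces known steps : reduces known steps ->
  {in known, forall b, spanned (orb b)} ->
  {in unzip1 steps, forall b, spanned (orb b)}.
Proof.
elim: steps known => //= -[b cs] steps IH known /and4P[cs21 b1 le_b red] Hk.
have Hb : spanned (orb b).
  set s := orbit_keys _ in b1 le_b.
  have /hitL_hit_terms := cs21.
  rewrite -sum_orbit_keys ?size_hit_terms // -/s => /spanned_hit.
  have /perm_to_rem perm_s : b \in s by rewrite -has_pred1 has_count (eqP b1).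
  rewrite (perm_big _ perm_s) big_cons => Hs.
  rewrite -[orb b]addr0 -(AA2 (\sum_(m <- rem b s) orb m)) addrA.
  apply: spanned_add => //; apply: spanned_sum => m m_s.
  apply: Hk; have := allP le_b m (mem_rem m_s); case: eqP => // Em _.
  (* Multiplicity one excludes a second occurrence of [b] among the remaining orbits. *)
  have /esym/eqP := permP perm_s (pred1 b).
  rewrite (eqP b1) /= eqxx add1n eqSS -leqn0 leqNgt -has_count has_pred1.
  by rewrite -{1}Em m_s.
move=> b'; rewrite inE => /predU1P[-> // | ]; apply: IH red _ b'.
by move=> m; rewrite inE => /predU1P[-> // | /Hk].
Qed.

Lemma spanned_orb b : size b = 5%N -> sumn b = 21%N -> (31 %| wt b)%N -> spanned (orb b).
Proof.
move=> b5 b21 b31; rewrite -orb_rot_max //.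
have b_in : b \in compositions 5 21 by have := mem_compositions b; rewrite b5 b21.
have /implyP/(_ _) := allP known_orbitsP b b_in; rewrite wt_ofE // => /(_ b31).
rewrite mem_cat => /orP[]; last exact: spanned_reps.
by apply: spanned_reduces reductionsP _ _; exact: spanned_reps.
Qed.

End Upper.

(** * The invariant line *)

Section Invariants.
Variables (L : fieldExtType 'F_2) (t : L).
Hypothesis tE : t ^+ 5 + t ^+ 4 + t ^+ 2 + t + 1 = 0.
Local Notation ymon := (ymon t).
Local Notation hitL := (@hitL L).
Local Notation orb := (orb t).
Local Notation kap := (kap t).

Lemma sum_same (V : lmodType L) (v : V) n : odd n -> \sum_(i < n) v = v.
Proof.
move=> n1; rewrite sumr_const card_ord -[n]odd_double_half n1 -mul2n mulrnDr.
by rewrite mulrnA mulr2n addxx mul0rn addr0.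
Qed.

(** For odd [n] a polynomial is the sum of [n] copies of itself, which takes the place of division
    by the order. Each w^j h + h is hit by induction: w^(j+1) h + h = w (w^j h + h) + (w h + h). *)
Lemma hitL_average w n (h : {mpoly L[5]}) : odd n -> hitL (substL w h + h) ->
  hitL (\sum_(j < n) iter j (substL w) h + h).
Proof.
move=> n1 Hw; rewrite -[X in _ + X](sum_same h n1) -big_split; apply: hitL_sum => -[j _] /=.
elim: j => [|j IHj]; first by rewrite (AA2 h); exact: hitL0.
rewrite iterS -[substL w _](addrK (substL w h)) oppxx.
rewrite -[X in X + _ + h]raddfD -addrA; apply: hitL_add => //.
exact: hitL_subst.
Qed.

Lemma yv_homog i : yv t i \is 1.-homog.
Proof. by apply: rpred_sum => j _; rewrite rpredZ // dhomogX /=; apply/eqP/mdeg1. Qed.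

Lemma ymon_homog b : size b = 5%N -> ymon b \is (sumn b).-homog.
Proof.
case: b => [|b0 [|b1 [|b2 [|b3 [|b4 []]]]]] // _.
rewrite /ymon !big_ord_recr big_ord0 /= mul1r addn0 !addnA.
by do !apply: dhomogM; rewrite -[X in X.-homog]mul1n dhomogMn ?yv_homog.
Qed.

Lemma yco_homog h n : h \is n.-homog -> yco t h \is n.-homog.
Proof.
move=> /dhomogP hn; rewrite /yco comp_mpolyEX big_seq; apply: rpred_sum => m m_h.
rewrite rpredZ // -ymonX.
have <- : sumn (val m) = n by rewrite -(hn _ m_h) [RHS]mdegE sumnE big_tuple.
by rewrite ymon_homog // size_tuple.
Qed.

Lemma embed_homog f n : f \is n.-homog -> embed L f \is n.-homog.
Proof.
move=> /dhomogP fn; rewrite /embed [f]mpolyE raddf_sum big_seq; apply: rpred_sum => m m_f.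
by rewrite /= -[map_mpoly _ _]/(embed L _) embedZ embedX rpredZ // dhomogX; apply/eqP/fn.
Qed.

Lemma component_homog i (h : {mpoly L[5]}) n : h \is n.-homog -> component i h \is n.-homog.
Proof.
move=> hn; apply/dhomogP => m; apply: contraTeq => mn.
rewrite mcoeff_msupp negbK mcoeff_map_mpoly (dhomog_nemf_coeff hn mn).
by rewrite /= raddf0.
Qed.

Lemma spanned_invariant h : h \is 21.-homog ->
  hitL (substL (mx_of singer) h + h) -> hitL (substL (mx_of cshift) h + h) ->
  spanned t h.
Proof.
move=> h21 /(@hitL_average _ 31)-/(_ isT) Hs /(@hitL_average _ 5)-/(_ isT) Hu.
set h1 := \sum_(j < 31) _ in Hs.
have Hh : hitL (orbsum h1 + h).
  rewrite -[orbsum h1](addrK (orbsum h)) oppxx -linearD -addrA; apply: hitL_add => //.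
  exact: (hitL_linear (@orbsum_SqL L)).
rewrite -[h]add0r -(AA2 (orbsum h1)) -addrA.
apply: spanned_add; last exact: spanned_hit.
(* In the eigenbasis the Singer average multiplies the coefficient of y^m by a geometric sum, so
   only weights divisible by 31 remain. *)
have -> : h1 = \sum_(m <- msupp (yco t h)) ((yco t h)@_m * (31 %| wt m)%:R) *: ymon m.
  under [RHS]eq_bigr do rewrite -(sum_th_pow tE) -scalerA scaler_suml scaler_sumr.
  rewrite exchange_big; apply: eq_bigr => j _.
  rewrite {1}(ymon_span tE h); elim/big_rec2: _ => [|m x y _ <-].
    by elim: (nat_of_ord j) => // k IHk; rewrite iterS IHk raddf0.
  by rewrite (iter_linear (substL (mx_of singer))) singer_ymon.
rewrite linear_sum; apply: spanned_sum => m m_h /=.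
have m5 : size m = 5%N by rewrite size_tuple.
rewrite -scalerA !orbsumZ orbsum_ymon //.
apply: spanned_scale; case m31: (31 %| wt m)%N; last first.
  by rewrite scale0r; apply/spanned_hit/hitL0.
rewrite scale1r; apply: spanned_orb => //.
have /dhomogP/(_ _ m_h) <- := yco_homog h21.
by rewrite [RHS]mdegE sumnE big_tuple.
Qed.

(** The solution of the equations in [detection]: coefficients 0, 2 and 4 vanish, and coefficients 1
    and 3 agree. *)
Definition inv_class : {mpoly L[5]} := orb (nth [::] reps 1) + orb (nth [::] reps 3).

Lemma kap_orb F b : all (fun m => size m == 5%N) F -> size b = 5%N ->
  kap F (orb b) = (odd (count (fun m => @lookup 5 m (trie_of 5 F)) (rots b)))%:R.
Proof.
move=> F5 b5; rewrite kap_sum -(sum_lookup L) big_map -[iota 0 5]/(index_iota 0 5) big_mkord.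
by apply: eq_bigr => i _; rewrite kap_ymon // size_rot.
Qed.

Lemma kap_orbs F s : all (fun m => size m == 5%N) F -> all (fun m => size m == 5%N) s ->
  kap F (\sum_(b <- s) orb b) = (parity F s)%:R.
Proof.
move=> F5; rewrite kap_sum /parity -(sum_lookup L) big_flatten big_map => /allP s5.
by apply: eq_big_seq => b /s5 /eqP b5; rewrite kap_orb // -sum_lookup.
Qed.

Lemma size_reps b : b \in reps -> size b = 5%N.
Proof. by move=> b_in; apply/eqP/(allP (isT : all (fun b => size b == 5%N) reps)). Qed.

Lemma eq_on_ymon (phi psi : {linear {mpoly L[5]} -> {mpoly L[5]}}) :
  (forall m : 'X_{1..5}, phi (ymon m) = psi (ymon m)) -> phi =1 psi.
Proof.
move=> E h; rewrite (ymon_span tE h) [LHS]linear_sum [RHS]linear_sum.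
by apply: eq_bigr => m _; rewrite !linearZ /= E.
Qed.

Lemma subst_comm w w' :
  (forall i, substL w (substL w' (yv t i)) = substL w' (substL w (yv t i))) ->
  forall h : {mpoly L[5]}, substL w (substL w' h) = substL w' (substL w h).
Proof.
move=> E; apply: (@eq_on_ymon (substL w \o substL w') (substL w' \o substL w)) => m.
rewrite /= !rmorph_prod; apply: eq_bigr => j _.
by rewrite /= !rmorphXn /= E.
Qed.

Lemma subst_yv_comm w w' :
  (forall i, substL w (yv t i) = yv t i + yv t i.+1 + yv t i.+2) ->
  (forall i, substL w' (yv t i) = yv t (i + 4)) ->
  forall i, substL w (substL w' (yv t i)) = substL w' (substL w (yv t i)).
Proof. by move=> E E' i; rewrite E' !E !raddfD /= !E'. Qed.

Lemma iter_subst_comm w w' i (h : {mpoly L[5]}) :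
  (forall g : {mpoly L[5]}, substL w (substL w' g) = substL w' (substL w g)) ->
  substL w (iter i (substL w') h) = iter i (substL w') (substL w h).
Proof. by move=> E; elim: i => [//|i IHi]; rewrite !iterS E IHi. Qed.

(** The circulant commutes with the shift, so the image of an orbit is the cyclic sum of the image
    of one monomial. *)
Lemma circ_orb b : b \in reps ->
  substL (mx_of circ) (orb b) = \sum_(m <- circ_image b) orb m.
Proof.
move=> b_in; have b5 := size_reps b_in.
have comm : substL (mx_of circ) (orb b) = orbsum (substL (mx_of circ) (ymon b)).
  rewrite -orbsum_ymon // raddf_sum; apply: eq_bigr => i _.
  apply: iter_subst_comm; apply: subst_comm.
  exact: subst_yv_comm (circ_yv tE) (cshift_yv tE).
rewrite comm -{1}(eqP (allP bits_ofP b b_in)) -circ_termsE; last first.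
- by apply/allP => u /flattenP[s /mapP[i i5 ->] /mapP[j _ ->]]; rewrite mem_iota in i5.
- exact: tE.
rewrite linear_sum; apply: eq_big_seq => m /(allP (circ_terms_size _)) /eqP m5.
exact: orbsum_ymon.
Qed.

Lemma inv_class_not_hit : ~ hitL inv_class.
Proof.
have kF := functional0_kills.
move=> /(kap_hit tE kF); have /andP[F5 _] := kF.
have -> : inv_class = \sum_(b <- [:: nth [::] reps 1; nth [::] reps 3]) orb b.
  by rewrite big_cons big_seq1.
have s5 : all (fun m => size m == 5%N) [:: nth [::] reps 1; nth [::] reps 3] by [].
by rewrite (kap_orbs F5 s5) functional0P => /eqP; rewrite oner_eq0.
Qed.

Lemma hitL_of_cert a b cs : a \in reps -> b \in reps -> all below21 cs ->
  orbit_keys (circ_image a ++ circ_image b ++ [:: a; b] ++ hit_terms cs) = [::] ->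
  hitL (substL (mx_of circ) (orb a + orb b) + (orb a + orb b)).
Proof.
move=> ra rb c21 cert; set s := _ ++ _ in cert.
have : \sum_(m <- orbit_keys s) orb m = 0 by rewrite cert big_nil.
have s5 c : all (fun m => size m == 5%N) (circ_image c) by exact: circ_terms_size.
rewrite sum_orbit_keys //; last first.
  by rewrite !all_cat !s5 size_hit_terms //= !size_reps.
rewrite !big_cat !big_cons big_nil /= -(circ_orb ra) -(circ_orb rb) addr0 => E.
have := hitL_hit_terms tE c21; rewrite raddfD /=.
move: (\sum_(m <- hit_terms _) _) (substL _ (orb a)) (substL _ (orb b)) E => u x y E.
suff -> : x + y + (orb a + orb b) = u by [].
by apply/eqP; rewrite -subr_eq0 oppxx -E; apply/eqP; ring.
Qed.

Lemma inv_class_circ : hitL (substL (mx_of circ) inv_class + inv_class).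
Proof.
have /andP[c21 /eqP cert] := circ_certP.
by apply: hitL_of_cert c21 cert; apply: mem_nth.
Qed.

Lemma solve_detection (c : nat -> L) (o : nat -> {mpoly L[5]}) :
  (c 0%N + c 4 = 0) * (c 0%N + c 2 = 0) * (c 0%N + c 2 + c 4 = 0) *
    (c 0%N + c 1%N + c 3 + c 4 = 0) ->
  \sum_(i < 5) c i *: o i = c 1%N *: (o 1%N + o 3).
Proof.
case=> [[[E04 E02]]]; rewrite E02 add0r => c4; move: E04 E02; rewrite c4 !addr0.
move=> c0; rewrite c0 !add0r => c2 /eqP; rewrite addr_eq0 (oppxx (c 3 : L^o)) => /eqP c13.
by rewrite !big_ord_recr big_ord0 /= c0 c2 c4 !scale0r !addr0 !add0r c13 scalerDr.
Qed.

Lemma invariant_proportional h : h \is 21.-homog ->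
  hitL (substL (mx_of singer) h + h) -> hitL (substL (mx_of cshift) h + h) ->
  hitL (substL (mx_of circ) h + h) -> exists c, hitL (h + c *: inv_class).
Proof.
move=> h21 Hs Hu Hg; have [c Hc] := spanned_invariant h21 Hs Hu.
set q := \sum_(i < 5) _ in Hc.
(* [h] and [q] agree modulo hits, so the circulant fixes [q] modulo hits as well. *)
have Hq : hitL (substL (mx_of circ) q + q).
  have := hitL_add (hitL_add (hitL_subst (mx_of circ) Hc) Hc) Hg.
  rewrite raddfD; set x := substL _ h; set y := substL _ q => /=.
  suff -> : x + y + (h + q) + (x + h) = y + q by [].
  transitivity (y + q + (x + x) + (h + h)); first by ring.
  by rewrite !AA2 !addr0.
have Eq : substL (mx_of circ) q + q = \sum_(i < 5)
    c i *: (substL (mx_of circ) (orb (nth [::] reps i)) + orb (nth [::] reps i)).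
  rewrite /q linear_sum -big_split; apply: eq_bigr => i _.
  by rewrite scalerDr -substLZ.
(* A functional vanishing on hits turns [Hq] into one linear equation in [c], with coefficients 0
   and 1. *)
have eqn F : kills F -> all (fun m => size m == 5%N) F ->
    \sum_(i < 5) c i * (parity F (nth [::] reps i :: circ_image (nth [::] reps i)))%:R = 0.
  move=> kF F5; rewrite -[RHS](kap_hit tE kF Hq) Eq kap_sum.
  apply: eq_bigr => i _; have r_in : nth [::] reps i \in reps by rewrite mem_nth.
  have s5 : all (fun m => size m == 5%N) (nth [::] reps i :: circ_image (nth [::] reps i)).
    by apply/andP; split; [rewrite size_reps | exact: circ_terms_size].
  by rewrite kapZ (circ_orb r_in) -(kap_orbs F5 s5) big_cons addrC.
have eqn_j j : (j < 4)%N ->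
    \sum_(i < 5) c i * (nth false (nth [::] detection i) j)%:R = 0.
  move=> j4; have kF := all_nthP [::] detectors_kill j j4.
  have /andP[F5 _] := kF; rewrite -[RHS](eqn _ kF F5); apply: eq_bigr => i _.
  have i5 : (i < size reps)%N := ltn_ord i.
  have jD : (j < size detectors)%N := j4.
  by rewrite -circ_imageP (nth_map [::] [::] _ i5) (nth_map [::] false _ jD).
have := (eqn_j 0%N isT, eqn_j 1%N isT, eqn_j 2%N isT, eqn_j 3%N isT).
rewrite !big_ord_recr !big_ord0 /= !mulr1 !mulr0 !addr0 !add0r => eqs.
exists (c 1%N); rewrite -(solve_detection (fun i => orb (nth [::] reps i)) eqs).
exact: Hc.
Qed.

End Invariants.

(** * Generation of the general linear group *)

Section Transvections.
Variables (n : nat) (P : 'M['F_2]_n -> Prop).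
Hypothesis P1 : P 1%:M.
Hypothesis PM : forall A B, P A -> P B -> P (A *m B).
Hypothesis PT : forall i j, i != j -> P (1%:M + delta_mx i j).

Lemma transvectionE (i j r c : 'I_n) (w : 'M['F_2]_n) :
  ((1%:M + delta_mx i j) *m w) r c = w r c + (r == i)%:R * w j c.
Proof.
rewrite mulmxDl mul1mx mxE; congr (_ + _); rewrite mxE (bigD1 j) //= mxE eqxx andbT.
by rewrite big1 ?addr0 // => k /negPf kj; rewrite mxE kj andbF mul0r.
Qed.

Lemma transvectionK (i j : 'I_n) : i != j ->
  (1%:M + delta_mx i j) *m (1%:M + delta_mx i j) = 1%:M :> 'M['F_2]_n.
Proof.
move=> ij; apply/matrixP => r c; rewrite transvectionE !mxE (eq_sym j i) (negPf ij).
rewrite addr0 -addrA; have [->|ri] := eqVneq r i; rewrite ?mul0r ?addr0 //= mul1r.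
rewrite (eq_sym c j); case: (j == c); rewrite ?addr0 //.
by rewrite (_ : 1 + 1 = 0 :> 'F_2) ?addr0 //; apply: val_inj.
Qed.

(** Over F_2 a transvection is its own inverse, so a row operation may be undone inside [P]. *)
Lemma transvection_ind (i j : 'I_n) w : i != j ->
  P ((1%:M + delta_mx i j) *m w) -> P w.
Proof.
by move=> ij Pw; rewrite -[w]mul1mx -(transvectionK ij) -mulmxA; apply: PM (PT ij) Pw.
Qed.

Lemma transvection_unit (i j : 'I_n) (w : 'M['F_2]_n) : i != j -> w \in unitmx ->
  (1%:M + delta_mx i j) *m w \in unitmx.
Proof.
by move=> ij wu; rewrite unitmx_mul wu andbT; have [] := mulmx1_unit (transvectionK ij).
Qed.

(** Gaussian elimination by row operations: the first [d] columns already agree with the identity,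
    and [k] bounds the number of columns left. Adding a row of index at least [d] preserves the
    finished columns, because its entries there are 0. *)
Lemma transvection_gen_from k d (w : 'M['F_2]_n) : w \in unitmx ->
  (forall r c : 'I_n, (c < d)%N -> w r c = (r == c)%:R) -> (n < k + d)%N -> P w.
Proof.
elim: k d w => [|k IHk] d w wu w1 kn.
  suff -> : w = 1%:M by [].
  by apply/matrixP => r c; rewrite w1 ?mxE // (ltn_trans (ltn_ord c)).
have [dn|nd] := ltnP d n; last first.
  suff -> : w = 1%:M by [].
  by apply/matrixP => r c; rewrite w1 ?mxE // (leq_trans (ltn_ord c)).
pose x := Ordinal dn.
have row0 (u : 'M['F_2]_n) (i : 'I_n) : (forall r c : 'I_n, (c < d)%N -> u r c = (r == c)%:R) ->
    (d <= i)%N -> forall c : 'I_n, (c < d)%N -> u i c = 0.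
  by move=> u1 di c cd; rewrite u1 // -val_eqE gtn_eqF // (leq_trans cd).
have keep (u : 'M['F_2]_n) (i j : 'I_n) : (d <= j)%N ->
    (forall r c : 'I_n, (c < d)%N -> u r c = (r == c)%:R) ->
    forall r c : 'I_n, (c < d)%N ->
      ((1%:M + delta_mx i j) *m u) r c = (r == c)%:R.
  by move=> dj u1 r c cd; rewrite transvectionE (row0 u j u1 dj) // mulr0 addr0 u1.
wlog wx : w wu w1 / w x x = 1.
  move=> H; have [w0|//] := F2_cases (w x x); last exact: H.
  have [i di wi] : exists2 i : 'I_n, (d < i)%N & w i x = 1.
    apply: contrapT => noi.
    (* If no lower row has a 1 in column [x], that column is a sum of earlier columns, which are
       unit vectors; [v] is then a non-zero vector in the kernel of [w]. *)
    pose v : 'cV['F_2]_n := \col_i (if (i < d)%N then w i x else 0) + delta_mx x 0.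
    have wv : w *m v = 0.
      rewrite mulmxDr -colE; apply/colP => r; rewrite !mxE.
      rewrite (eq_bigr (fun c : 'I_n => (r == c)%:R * (if (c < d)%N then w c x else 0))).
        rewrite (bigD1 r) //= eqxx mul1r big1 ?addr0 => [|c /negPf cr]; last first.
          by rewrite eq_sym cr mul0r.
        case: ltngtP => [rd|dr|rd].
        - by case: (F2_cases (w r x)) => ->; apply: val_inj.
        - have [->|wr] := F2_cases (w r x); rewrite ?addr0 //.
          by case: noi; exists r.
        - by rewrite (_ : r = x) ?w0 ?addr0 //; apply: val_inj.
      by move=> c _; rewrite mxE; case: ifP => cd; rewrite ?mulr0 ?(w1 r c).
    have v0 : v = 0 by rewrite -[v](mulKmx wu) wv mulmx0.
    have := congr1 (fun u : 'cV_n => u x 0) v0; rewrite !mxE ltnn !eqxx add0r.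
    by move/eqP; rewrite oner_eq0.
  have xi : x != i by rewrite -val_eqE neq_ltn di.
  apply: (transvection_ind xi); apply: H; first exact: transvection_unit.
    by apply: keep => //; apply: ltnW.
  by rewrite transvectionE w0 eqxx mul1r add0r.
(* Induction on the number of non-zero entries left in column [x] outside the pivot. *)
have [m] := ubnP #|[set i | (i != x) && (w i x != 0)]|.
elim: m w wu w1 wx => // m IHm w wu w1 wx.
rewrite ltnS => le_m.
case: (pickP (fun i => (i != x) && (w i x != 0))) => [i /andP[ix wi]|w0].
  apply: (transvection_ind ix); apply: IHm; first exact: transvection_unit.
  - by apply: keep.
  - by rewrite transvectionE eq_sym (negPf ix) mul0r addr0.
  apply: leq_trans le_m; apply/proper_card/properP; split.
    apply/subsetP => r; rewrite !inE transvectionE wx mulr1.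
    case/andP=> -> /=; have [->|_] := eqVneq r i; first by rewrite wi.
    by rewrite addr0.
  exists i; rewrite !inE ?ix // transvectionE eqxx mul1r wx /=.
  have [E|->] := F2_cases (w i x); first by rewrite E eqxx in wi.
  by rewrite negbK; apply/eqP/val_inj.
apply: (IHk d.+1) => //; last by rewrite addnS -addSn.
move=> r c; rewrite ltnS leq_eqVlt => /orP[/eqP cd|]; last exact: w1.
have -> : c = x by apply: val_inj.
have [->|rx] := eqVneq r x; first by rewrite wx.
by have := w0 r; rewrite rx /= => /negbFE/eqP.
Qed.

Lemma transvection_gen w : w \in unitmx -> P w.
Proof. by move=> wu; apply: (@transvection_gen_from n.+1 0 w) => //; rewrite addn0. Qed.

End Transvections.

(** * Transvections as words in the three generators *)

Definition rows_of (f : nat -> nat -> bool) : seq (seq nat) :=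
  [seq [seq nat_of_bool (f i j) | j <- iota 0 5] | i <- iota 0 5].

Definition rows_mul (a b : seq (seq nat)) : seq (seq nat) :=
  rows_of (fun i j => odd (sumn
    [seq (nth 0 (nth [::] a i) k * nth 0 (nth [::] b k) j)%N | k <- iota 0 5])).

Definition rows_prod := foldr rows_mul (rows_of (fun i j => i == j)).

Definition transv_rows i j := rows_of (fun r c => (r == c) || (r == i) && (c == j)).

(** The product of this word is the transvection (3, 4), indices counted from 0; conjugation by the
    power i + 2 of the shift, that is i - 3 modulo 5, moves it to (i, i + 1). *)
Definition base_word :=
  nseq 7 singer ++ nseq 4 circ ++ nseq 3 singer ++ circ :: nseq 3 singer
  ++ nseq 13 circ ++ nseq 5 singer.

(* The conjugates of [base_word] by the cyclic shift are the transvections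
   (i, i + 1); commutators [E_ij, E_jk] = E_ik then give all the others. *)
Fixpoint transv d i : seq (seq nat) :=
  let a := rows_prod (nseq ((i + 2) %% 5)%N cshift ++ base_word
                      ++ nseq ((13 - i %% 5) %% 5)%N cshift) in
  if d is d'.+1 then let b := transv d' i.+1 in rows_prod [:: a; b; a; b] else a.

Lemma transvP : all (fun i => all (fun d =>
  transv d i == transv_rows i ((i + d.+1) %% 5)%N) (iota 0 4)) (iota 0 5).
Proof. by vm_compute. Qed.

Lemma mx_of_rows f : mx_of (rows_of f) = \matrix_(i, j) (f i j)%:R.
Proof.
apply/matrixP => i j; rewrite !mxE (nth_map 0%N) ?size_iota // nth_iota //.
by rewrite (nth_map 0%N) ?size_iota // nth_iota.
Qed.

Lemma F2_natr_odd n : (odd n)%:R = n%:R :> 'F_2.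
Proof.
rewrite -[in RHS](odd_double_half n) natrD -mul2n natrM.
by rewrite (_ : 2%:R = 0 :> 'F_2) ?mul0r ?addr0 //; apply: val_inj.
Qed.

Lemma mx_of_mul a b : mx_of (rows_mul a b) = mx_of a *m mx_of b.
Proof.
apply/matrixP => i j; rewrite mx_of_rows !mxE F2_natr_odd sumnE big_map natr_sum.
rewrite -[iota 0 5]/(index_iota 0 5) big_mkord; apply: eq_bigr => k _.
by rewrite !mxE natrM.
Qed.

Lemma rows_prod_closed (P : 'M['F_2]_5 -> Prop) ws :
  P 1%:M -> (forall A B, P A -> P B -> P (A *m B)) ->
  (forall a, a \in ws -> P (mx_of a)) -> P (mx_of (rows_prod ws)).
Proof.
move=> P1 PM; elim: ws => [|a ws IH] Pws /=.
  rewrite mx_of_rows (_ : \matrix_(_, _) _ = 1%:M) //.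
  by apply/matrixP => i j; rewrite !mxE.
rewrite mx_of_mul; apply: PM; first by apply: Pws; rewrite mem_head.
by apply: IH => b b_in; apply: Pws; rewrite inE b_in orbT.
Qed.

Section Generation.
Variable P : 'M['F_2]_5 -> Prop.
Hypothesis P1 : P 1%:M.
Hypothesis PM : forall A B, P A -> P B -> P (A *m B).
Hypothesis Ps : P (mx_of singer).
Hypothesis Pc : P (mx_of cshift).
Hypothesis Pg : P (mx_of circ).

Lemma gens_closed ws : all (mem [:: singer; cshift; circ]) ws -> P (mx_of (rows_prod ws)).
Proof.
move=> /allP ws_in; apply: rows_prod_closed => // a /ws_in.
by rewrite !inE => /or3P[]/eqP->.
Qed.

Lemma transv_closed d i : P (mx_of (transv d i)).
Proof.
have Pa j : P (mx_of (transv 0 j)).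
  by apply: gens_closed; rewrite !all_cat !all_nseq !orbT.
elim: d i => [|d IHd] i; first exact: Pa.
apply: rows_prod_closed => // c; rewrite !inE.
by case/or4P=> /eqP->; first [exact: (Pa i) | exact: IHd].
Qed.

Lemma GL5_gen w : w \in unitmx -> P w.
Proof.
apply: transvection_gen => // i j ij.
have [d d4 Ej] : exists2 d, (d < 4)%N & ((i + d.+1) %% 5)%N = j.
  (* [d + 1] is the cyclic distance from [i] to [j], between 1 and 4 because they differ. *)
  exists ((j + 4 - i) %% 5)%N; move: i j ij => [i i5] [j j5]; rewrite -val_eqE /=; lia.
have /eqP E : transv d i == transv_rows i ((i + d.+1) %% 5)%N.
  have /(allP transvP)/allP : (i : nat) \in iota 0 5 by rewrite mem_iota ltn_ord.
  by apply; rewrite mem_iota.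
have := transv_closed d i; rewrite E.
rewrite Ej mx_of_rows; congr P; apply/matrixP => r c; rewrite !mxE -!val_eqE /=.
case: eqVneq => [rc|_] /=; last by rewrite add0r.
have -> : (val r == val i) && (val c == val j) = false.
  by apply/negP => /andP[/eqP ri /eqP cj]; case/eqP: ij; apply: val_inj; rewrite -ri -cj.
by rewrite addr0.
Qed.

End Generation.

(** A matrix with a power equal to 1 is invertible; the powers 31, 5 and 15 serve for the Singer
    cycle, the shift and the circulant. *)
Lemma gens_unit w : w \in [:: singer; cshift; circ] -> mx_of w \in unitmx.
Proof.
move=> w_in; have [k] : exists k, rows_prod (w :: nseq k w) == rows_prod [::].
  move: w_in; rewrite !inE => /or3P[]/eqP->.
  - by exists 30%N; vm_compute.
  - by exists 4; vm_compute.
  - by exists 14%N; vm_compute.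
move/eqP/(congr1 mx_of); rewrite /= mx_of_mul mx_of_rows.
rewrite (_ : \matrix_(_, _) _ = 1%:M); first by case/mulmx1_unit.
by apply/matrixP => i j; rewrite !mxE.
Qed.

(** * The theorem *)

(** This makes the orbit sums fixed by the Singer cycle, which scales y^c by a power of t^31 = 1. *)
Lemma reps_rots_wt :
  all (fun b => all (fun c => 31 %| wt_of c)%N (rots b)) reps.
Proof. by []. Qed.

Lemma reps_sumn : all (fun b => sumn b == 21%N) reps.
Proof. by []. Qed.

Lemma subst_mx1 (f : Pol 5) : subst_mx 1%:M f = f.
Proof.
have := @mpoly_rmorph_ext 5 _ (subst_mx 1%:M) idfun _ f; apply=> j /=.
rewrite subst_mx_X (bigD1 j) //= mxE eqxx scale1r big1 ?addr0 // => i ij.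
by rewrite mxE (negPf ij) scale0r.
Qed.

Lemma subst_mxM (A B : 'M['F_2]_5) (f : Pol 5) :
  subst_mx (A *m B) f = subst_mx A (subst_mx B f).
Proof.
have := @mpoly_rmorph_ext 5 _ (subst_mx (A *m B)) (subst_mx A \o subst_mx B) _ f.
apply=> j /=; rewrite !subst_mx_X raddf_sum /=.
under [RHS]eq_bigr => k _ do rewrite linearZ /= subst_mx_X scaler_sumr.
rewrite exchange_big; apply: eq_bigr => i _; rewrite mxE scaler_suml.
by apply: eq_bigr => k _; rewrite scalerA mulrC.
Qed.

(** Hits are stable under substitution, so the matrices fixing [f] modulo hits are closed under
    products, and the generators suffice. *)
Lemma subst_GL5 (f : Pol 5) :
  (forall a, a \in [:: singer; cshift; circ] -> subst_mx (mx_of a) f - f \in @hit 5) ->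
  forall w, w \in unitmx -> subst_mx w f - f \in @hit 5.
Proof.
move=> Pgen; apply: GL5_gen.
- by rewrite subst_mx1 subrr rpred0.
- move=> A B PA PB; rewrite subst_mxM; move: (subst_mx B f) PB => g PB.
  have E : subst_mx A (g - f) = subst_mx A g - subst_mx A f := raddfB _ _ _.
  have : subst_mx A (g - f) + (subst_mx A f - f) \in @hit 5.
    by apply: rpredD => //; apply: hit_subst.
  by rewrite E; move: (subst_mx A g) (subst_mx A f) => x y; rewrite subrKA.
- by apply: Pgen; rewrite mem_head.
- by apply: Pgen; rewrite inE mem_head orbT.
- by apply: Pgen; rewrite !inE eqxx !orbT.
Qed.

Section Generator.
Variables (L : fieldExtType 'F_2) (t : L).
Hypothesis tE : t ^+ 5 + t ^+ 4 + t ^+ 2 + t + 1 = 0.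
Local Notation hitL := (@hitL L).
Local Notation orb := (orb t).
Local Notation inv_class := (inv_class t).

Lemma orb_homog b : b \in reps -> orb b \is 21.-homog.
Proof.
move=> b_in; have b5 := size_reps b_in; apply: rpred_sum => i _.
have <- : sumn (rot i b) = 21%N.
  rewrite -(eqP (allP reps_sumn b b_in)); apply: perm_sumn.
  by rewrite perm_rot.
by apply: ymon_homog; rewrite size_rot.
Qed.

Lemma singer_orb b : b \in reps -> substL (mx_of singer) (orb b) = orb b.
Proof.
move=> b_in; have b5 := size_reps b_in; rewrite [LHS]linear_sum.
apply: eq_bigr => i _; have := singer_ymon tE 1 (rot i b) => /= ->.
have c_in : rot i b \in rots b by apply: (map_f (fun i => rot i b)); rewrite mem_iota ltn_ord.
have := allP (allP reps_rots_wt b b_in) _ c_in; rewrite wt_ofE ?size_rot //.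
by case/dvdnP=> q ->; rewrite mulnC exprM th_expr31 // !expr1n scale1r.
Qed.

Lemma cshift_orb b : b \in reps -> substL (mx_of cshift) (orb b) = orb b.
Proof.
move=> b_in; have b5 := size_reps b_in; rewrite -[RHS](orb_rot t 1) // [LHS]linear_sum.
by apply: eq_bigr => i _; rewrite rot_rot -cshift_ymon ?size_rot.
Qed.

Lemma reps1 : nth [::] reps 1 \in reps. Proof. exact: mem_nth. Qed.
Lemma reps3 : nth [::] reps 3 \in reps. Proof. exact: mem_nth. Qed.

Lemma inv_class_homog : inv_class \is 21.-homog.
Proof. by rewrite rpredD ?orb_homog ?reps1 ?reps3. Qed.

Lemma inv_class_gens w : w \in [:: singer; cshift; circ] ->
  hitL (substL (mx_of w) inv_class + inv_class).
Proof.
have zero u : u = inv_class -> hitL (u + inv_class).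
  by move=> ->; rewrite AA2; exact: hitL0.
rewrite !inE => /or3P[]/eqP->; last exact: inv_class_circ.
- apply: zero; apply: etrans (raddfD _ _ _) _.
  by congr (_ + _); apply: singer_orb; [exact: reps1 | exact: reps3].
- apply: zero; apply: etrans (raddfD _ _ _) _.
  by congr (_ + _); apply: cshift_orb; [exact: reps1 | exact: reps3].
Qed.

(** The class is an [L]-combination of its components; were they all hit over F_2, it would be hit
    over [L]. *)
Lemma exists_component_not_hit : exists i, component i inv_class \notin @hit 5.
Proof.
apply: contrapT => noi; apply: (inv_class_not_hit tE).
rewrite [X in hitL X]componentE; apply: hitL_sum => i; apply/hitL_scale/hitL_embed.
by apply: contrapT => /negP ni; case: noi; exists i.
Qed.

Lemma subst_component i w : w \in unitmx ->
  subst_mx w (component i inv_class) - component i inv_class \in @hit 5.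
Proof.
apply: subst_GL5 => a a_in; rewrite -component_subst -raddfB oppxx.
exact/hitL_component/inv_class_gens.
Qed.

End Generator.

Lemma cls_hit d (f : Pol d) : (cls f = 0) <-> (f \in @hit d).
Proof.
have := cls_eqP f 0; rewrite subr0 raddf0 => H.
by split=> ?; apply/H.
Qed.

Lemma scale_cls d (a : 'F_2) (f : Pol d) : a *: cls f = cls (a *: f).
Proof. exact: QPscale_cls. Qed.

Lemma QPinv_cls d n (f : Pol d) : f \is n.-homog ->
  (forall w, w \in unitmx -> subst_mx w f - f \in @hit d) -> QPinv n (cls f).
Proof.
move=> fn Hf; split; first by exists f.
by move=> w /Hf Hw; rewrite QPact_cls; apply/cls_eqP.
Qed.

Lemma exists_generator : exists p : Pol 5, [/\ QPinv 21 (cls p), cls p <> 0 &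
  forall c, QPinv 21 c -> exists a : 'F_2, c = a *: cls p].
Proof.
have [L [t tE]] := exists_theta.
have prop f : f \is 21.-homog ->
    (forall w, w \in unitmx -> subst_mx w f - f \in @hit 5) ->
    exists c, hitL (embed L f + c *: inv_class t).
  move=> f21 Hf; have H a : a \in [:: singer; cshift; circ] ->
      hitL (substL (mx_of a) (embed L f) + embed L f).
    move=> /gens_unit/Hf/(hitL_embed L); rewrite raddfB /= embed_subst.
    by rewrite oppxx.
  apply: (invariant_proportional tE (embed_homog L f21)); apply: H.
  - by rewrite mem_head.
  - by rewrite inE mem_head orbT.
  - by rewrite !inE eqxx !orbT.
have [i p_nhit] := exists_component_not_hit tE.
have p21 := component_homog i (inv_class_homog t).
have p_inv := @subst_component _ _ tE i.
move: (component i _) p_nhit p21 p_inv => p p_nhit p21 p_inv; exists p; split.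
- exact: QPinv_cls.
- by move/cls_hit => p_hit; rewrite p_hit in p_nhit.
move=> _ [[f f21 ->] f_inv].
have [c Hc] : exists c, hitL (embed L f + c *: inv_class t).
  apply: prop => // w wu; apply/cls_eqP.
  by rewrite -QPact_cls; apply: f_inv.
have [d Hd] := prop p p21 p_inv.
have [r rE] := exists_retraction L.
(* Over [L], [p] is [d] times the invariant class modulo hits; d = 0 would make [embed L p] hit, and
   then [p] by the retraction. *)
have d0 : d != 0.
  apply: contraNneq p_nhit => d0; rewrite -(rE p); apply: hitL_component.
  by rewrite -[embed L p]addr0 -(scale0r (inv_class t)) -d0.
have Hfp : hitL (embed L f + (c / d) *: embed L p).
  have := hitL_add Hc (hitL_scale (c / d) Hd).
  move: (embed L f) (embed L p) (inv_class t) => x y z.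
  by rewrite scalerDr scalerA (divfK d0) addrACA AA2 addr0.
(* Over [L], [f] is [c / d] times [p] modulo hits; the retraction replaces this scalar by its
   coordinate in F_2. *)
exists (coordL r (c / d)); rewrite scale_cls; apply/cls_eqP.
have := hitL_component r Hfp.
have E : component r (embed L f + (c / d) *: embed L p) =
    component r (embed L f) + component r ((c / d) *: embed L p) := raddfD _ _ _.
rewrite E rE component_embed -scaleNr (_ : - coordL r (c / d) = coordL r (c / d)) //.
by have [->|->] := F2_cases (coordL r (c / d)); apply: val_inj.
Qed.

Lemma QPinv0 d n : QPinv n (0 : QP d).
Proof.
rewrite (_ : 0 = cls 0 :> QP d); last by rewrite raddf0.
by apply: QPinv_cls => [|w _]; [exact: rpred0 | rewrite raddf0 subrr rpred0].
Qed.

Theorem theorem1p2 :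
  (exists! c : QP 5, QPinv 21 c /\ c <> 0) /\ has_dim (@QPinv 5 21) 1.
Proof.
have [p [p_inv p0 p_gen]] := exists_generator.
(* A line over F_2 has a single non-zero element, which gives uniqueness. *)
have F2P (a : 'F_2) : a *: cls p = 0 \/ a *: cls p = cls p.
  by have [->|->] := F2_cases a; rewrite ?scale0r ?scale1r; [left | right].
split.
  exists (cls p); split=> // c [/p_gen[a ->] c0].
  by have [E|->] := F2P a; first case: c0.
exists (fun=> cls p); split=> [a|c].
  rewrite big_ord1 => E i; rewrite (ord1 i).
  by have [//|a1] := F2_cases (a ord0); rewrite a1 scale1r in E.
split=> [/p_gen[a ->]|[a ->]].
  by exists (fun=> a); rewrite big_ord1.
by rewrite big_ord1; have [->|->] := F2P (a ord0); [exact: QPinv0 | exact: p_inv].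
Qed.
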